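(* Let $G\subset U(V)$ be a finite complex reflection group and $k=(k_{C,i})$ a tuple of real parameters. The radical $\operatorname{Rad}(k)=\{p\in P\mid(p,P)_k=0\}$ of $(\cdot,\cdot)_k$ is the unique maximal proper $\mathbb{A}(k)$-submodule of $P$. In particular, $P$ is not irreducible as an $\mathbb{A}(k)$-module if and only if $k$ is singular, and $P/\operatorname{Rad}(k)$ is the unique simple quotient of the $\mathbb{A}(k)$-module $P$.
   Context: $V$ is a finite dimensional complex Hilbert space with inner product $(\cdot,\cdot)$ linear in the second and anti-linear in the first variable. A complex reflection is an element $g\in U(V)$ of finite order such that $\operatorname{Ker}(g-\operatorname{Id})$ is a hyperplane; a finite complex reflection group is a finite subgroup $G\subset U(V)$ generated by complex reflections. For a hyperplane $H$, $G_H\subset G$ is the (cyclic) pointwise stabilizer; $H$ is a reflection hyperplane if $G_H\ne\{\operatorname{Id}\}$, and then $e_H=|G_H|$. $\mathcal{A}$ is the set of reflection hyperplanes, $\mathcal{C}$ the set of $G$-orbits in $\mathcal{A}$; $e_C=e_H$ for $H\in C$. $\chi_H=\det|_{G_H}$. Choose $\alpha_H\in V^*$ with kernel $H$. $P$ is the ring of complex polynomials on $V$, with $G$-action $p^g(x)=p(g^{-1}x)$. Parameters $k=(k_{C,i})$, $C\in\mathcal{C}$, $1\le i\le e_C-1$; $k_{H,i}=k_{C,i}$ if $H\in C$. Put $\epsilon_{H,i}=\frac1{e_H}\sum_{g\in G_H}\chi_H^i(g)g$, $a_H(k)=\sum_{i=1}^{e_H-1}e_Hk_{H,i}\epsilon_{H,i}$,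 and for $\xi\in V$ define on $P$ the (mutually commuting) operators $$T_\xi(k)=\partial_\xi+\sum_{H\in\mathcal{A}}\alpha_H(\xi)\alpha_H^{-1}a_H(k).$$ $\mathbb{A}(k)\subset\operatorname{End}(P)$ (the rational Cherednik algebra) is the algebra generated by the operators of $\mathbb{C}[G]$, the $T_\xi(k)$ ($\xi\in V$), and multiplications by elements of $P$. $k$ is called singular if there is a nonzero homogeneous polynomial $p\in P$ of positive degree with $T_\xi(k)p=0$ for all $\xi\in V$. For $\xi\in V$ let $\xi^*\in V^*$ be $\xi^*(\eta)=(\xi,\eta)$; extend $\xi\mapsto\xi^*$ to an anti-linear ring isomorphism $*:S\to P$ from the symmetric algebra $S$ of $V$, with inverse also denoted $*$. The map $\xi\mapsto T_\xi(k)$ extends to an algebra homomorphism $s\mapsto s(T(k))$, $S\to\operatorname{End}(P)$. The pairing is $(p,q)_k=(p^*(T(k))q)(0)$; for real $k$ it is hermitian. *)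

(* Defs.v *)
From HB Require Import structures.
From mathcomp Require Import all_boot all_order all_algebra finmap complex.
From mathcomp Require Import generic_quotient ring_quotient.
From mathcomp Require Import boolp classical_sets fsbigop reals mpoly.

Set Implicit Arguments.
Unset Strict Implicit.
Unset Printing Implicit Defensive.

Import Order.TTheory GRing.Theory Num.Theory.
Local Open Scope classical_set_scope.
Local Open Scope ring_scope.

(* Polynomials on V, and elements of the symmetric algebra of V, are both
   represented in {mpoly C[\dim {:V}]}, relative to the basis vbasis {:V}:
   - in a polynomial on V, 'X_i is the i-th coordinate function;
   - in an element of the symmetric algebra, 'X_i is the i-th basis vector. *)

Section ReflectionGroups.
Variables (C : numClosedFieldType) (V : vectType C).

Definition dimV := \dim {:V}.
Definition bas (i : 'I_dimV) : V := (vbasis {:V})`_i.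
Definition crd (i : 'I_dimV) (v : V) : C := coord (vbasis {:V}) i v.

Record inner_product (ip : V -> V -> C) : Prop := InnerProduct {
  ip_linear : forall x a y z, ip x (a *: y + z) = a * ip x y + ip x z;
  ip_conj : forall x y, ip y x = (ip x y)^*;
  ip_pos : forall x, x != 0 -> 0 < ip x x }.

Definition det (g : 'End(V)) : C := \det (\matrix_(i, j) crd i (g (bas j))).

Definition is_hyperplane (H : {vspace V}) : Prop := (\dim H).+1 = dimV.

Definition unitary (ip : V -> V -> C) (g : 'End(V)) : Prop :=
  forall x y, ip (g x) (g y) = ip x y.

Definition finite_order (g : 'End(V)) : Prop :=
  exists2 m : nat, (0 < m)%N & iter m (comp_lfun g) \1%VF = \1%VF.

Definition complex_reflection (ip : V -> V -> C) (g : 'End(V)) : Prop :=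
  [/\ unitary ip g, finite_order g & is_hyperplane (lker (g - \1%VF))].

Definition unitary_subgroup (ip : V -> V -> C) (K : set 'End(V)) : Prop :=
  [/\ forall g, K g -> unitary ip g,
      K \1%VF,
      forall g h, K g -> K h -> K (g \o h)%VF
    & forall g, K g -> K (g^-1)%VF].

Definition complex_reflection_group (ip : V -> V -> C) (G : {fset 'End(V)}) :
    Prop :=
  unitary_subgroup ip [set` G] /\
  exists X : set 'End(V),
    [/\ forall g, X g -> complex_reflection ip g,
        X `<=` [set` G]
      & forall K, unitary_subgroup ip K -> X `<=` K -> [set` G] `<=` K].

Definition stab (G : {fset 'End(V)}) (H : {vspace V}) : {fset 'End(V)} :=
  [fset g in G | (H <= lker (g - \1%VF))%VS]%fset.

Definition reflection_hyperplane (G : {fset 'End(V)}) : set {vspace V} :=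
  [set H | is_hyperplane H /\ stab G H <> [fset \1%VF]%fset].

Definition hyp_orbit (G : {fset 'End(V)}) (H : {vspace V}) : set {vspace V} :=
  [set H' | exists2 g, g \in G & H' = (g @: H)%VS].

End ReflectionGroups.

Section Operators.
Variables (C : numClosedFieldType) (V : vectType C).
Local Notation P := {mpoly C[dimV V]}.
Local Notation S := {mpoly C[dimV V]}.

Definition linpoly (f : V -> C) : P := \sum_(i < dimV V) f (bas i) *: 'X_i.

(* (g p)(x) = p(g^-1 x) *)
Definition gact (g : 'End(V)) (p : P) : P :=
  p \mPo [tuple linpoly (fun x => crd i ((g^-1)%VF x)) | i < dimV V].

Definition dderiv (xi : V) (p : P) : P :=
  \sum_(i < dimV V) crd i xi *: p^`M(i).

(* p / a; it is 0 by convention if a does not divide p, which never occurs for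
   a = alpha_H and p in the image of a_H below. *)
Definition divp_lin (a p : P) : P := xget 0 [set q | a * q = p].

Variables (G : {fset 'End(V)}) (alpha : {vspace V} -> 'Hom(V, C^o)).
(* The parameter k_{O,i} is k O i; values of k at sets O that are not orbits of
   reflection hyperplanes, or at i outside 1..e_O-1, are never used. *)
Variable k : set {vspace V} -> nat -> C.

Definition eH (H : {vspace V}) : nat := #|` stab G H|.

Definition epsilon (H : {vspace V}) (i : nat) (p : P) : P :=
  (eH H)%:R^-1 *: \sum_(g <- stab G H) det g ^+ i *: gact g p.

Definition aH (H : {vspace V}) (p : P) : P :=
  \sum_(1 <= i < eH H) ((eH H)%:R * k (hyp_orbit G H) i) *: epsilon H i p.

Definition dunkl (xi : V) (p : P) : P :=
  dderiv xi p +
  \sum_(H \in reflection_hyperplane G)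
     alpha H xi *: divp_lin (linpoly (alpha H)) (aH H p).

Inductive gen_algebra (X : set (P -> P)) : set (P -> P) :=
| gen_in f of X f : gen_algebra X f
| gen_one : gen_algebra X id
| gen_scale (c : C) f of gen_algebra X f : gen_algebra X (fun p => c *: f p)
| gen_add f g of gen_algebra X f & gen_algebra X g :
    gen_algebra X (fun p => f p + g p)
| gen_comp f g of gen_algebra X f & gen_algebra X g : gen_algebra X (f \o g).

Definition cherednik : set (P -> P) :=
  gen_algebra ([set gact g | g in [set` G]]
               `|` [set dunkl xi | xi in [set: V]]
               `|` [set (fun p => q * p) | q in [set: P]]).

Definition singular : Prop :=
  exists (p : P) (d : nat),
    [/\ p != 0, (0 < d)%N, p \is d.-homog & forall xi, dunkl xi p = 0].

(* s(T(k)); since the T_xi commute, the order in which they are composed is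
   irrelevant and s |-> s(T(k)) is the algebra morphism extending
   xi |-> T_xi(k) (and T_xi is linear in xi). *)
Definition eval_dunkl (s : S) (q : P) : P :=
  \sum_(m <- msupp s)
     s@_m *: (\big[(fun f g : P -> P => f \o g)/id]_(i < dimV V)
                 iter (m i) (dunkl (bas i))) q.

Variable ip : V -> V -> C.

(* The anti-linear ring morphism extending xi |-> ip xi; it is bijective when
   ip is an inner product, and unstar is then its inverse. *)
Definition star (s : S) : P :=
  map_mpoly Num.conj s \mPo [tuple linpoly (ip (bas i)) | i < dimV V].

Definition unstar (p : P) : S := xget 0 [set s | star s = p].

Definition pairing (p q : P) : C := (eval_dunkl (unstar p) q).@[fun=> 0].

Definition Rad : set P := [set p | forall q, pairing p q = 0].

End Operators.

Section Modules.
Variables (P : zmodType) (A : set (P -> P)).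

(* Modules over an algebra A of operators on P: M is an abelian group and act
   gives the action of the operators in A (its values outside A are not used).
   Scalars act through the multiples of id in A. *)
Definition submodule (M : zmodType) (act : (P -> P) -> M -> M) (N : set M) :=
  [/\ N 0,
      forall x y, N x -> N y -> N (x - y)
    & forall a x, A a -> N x -> N (act a x)].

Definition simple_module (M : zmodType) (act : (P -> P) -> M -> M) : Prop :=
  (exists x : M, x != 0) /\
  forall N : set M, submodule act N -> N = [set 0] \/ N = [set: M].

Definition nat_act (a : P -> P) (p : P) : P := a p.

Definition maximal_proper_submodule (N : set P) : Prop :=
  [/\ submodule nat_act N, N <> [set: P]
    & forall N', submodule nat_act N' -> N' <> [set: P] ->
        N `<=` N' -> N' = N].

Definition submod_pred (N : set P) (hN : submodule nat_act N) : {pred P} :=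
  fun p => `[< N p >].

Lemma submod_pred_zmod (N : set P) (hN : submodule nat_act N) :
  zmod_closed (submod_pred hN).
Proof.
have [N0 NB _] := hN; split; first exact/asboolP.
by move=> x y /asboolP Nx /asboolP Ny; apply/asboolP; apply: NB.
Qed.

HB.instance Definition _ (N : set P) (hN : submodule nat_act N) :=
  GRing.isZmodClosed.Build P (submod_pred hN) (submod_pred_zmod hN).

Definition quot_module (N : set P) (hN : submodule nat_act N) :=
  Quotient.quot (submod_pred hN).

(* p + N |-> a p + N, well defined for a in A when a is additive *)
Definition quot_act (N : set P) (hN : submodule nat_act N)
    (a : P -> P) (x : quot_module hN) : quot_module hN :=
  \pi_(quot_module hN)%qT (a (repr x)).

End Modules.

(* Main.v *)
Require Import Defs.
From HB Require Import structures.
From mathcomp Require Import all_boot all_order all_algebra finmap complex.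
From mathcomp Require Import generic_quotient ring_quotient.
From mathcomp Require Import boolp classical_sets fsbigop reals mpoly.
From mathcomp Require Import cardinality.

(* Write c_g for the sum, over the reflection hyperplanes H fixed pointwise by g,
   of the k_{H,i} det(g)^i.  For a linear form x,
     T_xi (x p) = x T_xi p + x(xi) p + sum_g c_g x(g^-1 xi - xi) g p,
   because the sum of det^i over G_H vanishes for 0 < i < e_H.  Together with
   T_xi 1 = 0 this relation determines T_xi, and everything else follows from it:
   - g T_xi g^-1 = T_{g xi} holds since both sides satisfy the same relation;
   - [T_xi, T_eta] kills 1 and commutes with linear forms, because
     c_g x(g^-1 xi - xi) (T_{g eta} - T_eta) is symmetric in xi and eta, the
     operator g^-1 - 1 being of rank one when c_g <> 0;
   - the operator sum_i x_i T_{e_i} - sum_g c_g (g - 1) of A(k) is the Euler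
     operator, so that submodules of P are graded;
   - multiplication by xi^* and T_xi are adjoint on both sides for the pairing,
     which is therefore hermitian and has a submodule as radical.
   An element q of a proper submodule has no constant term, and the same holds for
   p^*(T) q, so that (p, q) = 0 for all p: the radical contains every proper
   submodule.  A nonzero element of least degree in the radical is killed by all
   the T_xi. *)

Set Implicit Arguments.
Unset Strict Implicit.
Unset Printing Implicit Defensive.

Import Order.TTheory GRing.Theory Num.Theory.
Local Open Scope classical_set_scope.
Local Open Scope ring_scope.

(** * Linear substitutions and finite unitary groups *)

Section LinearSubstitution.
Variables (C : numClosedFieldType) (V : vectType C).
Local Notation P := {mpoly C[dimV V]}.

(** The standard induction here: a linear operator on polynomials is pinned down by its value at 1
    and its commutation with the coordinates, so identities of operators are checked on 1 and
    carried through multiplication by ['X_i]. *)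
Lemma mpoly_ind_X (Q : P -> Prop) :
  Q 1 -> (forall a p q, Q p -> Q q -> Q (a *: p + q)) ->
  (forall i p, Q p -> Q ('X_i * p)) -> forall p, Q p.
Proof.
move=> Q1 QD QX p.
have Q0 : Q 0 by rewrite -(addNr 1) -scaleN1r; apply: QD.
elim/mpolyind: p => // a m p _ _ Qp; apply: QD => //.
rewrite mpolyXE_id; elim/big_rec: _ => // i q _ Qq.
elim: (m i) => [|e IHe]; first by rewrite mul1r.
by rewrite exprS -mulrA; apply: QX.
Qed.

Lemma crd_lin i : scalar (@crd C V i).
Proof. by move=> a x y; rewrite /crd linearP. Qed.

Lemma crd_bas i j : crd i (bas j : V) = (i == j)%:R.
Proof. by rewrite /crd /bas coord_free ?(basis_free (vbasisP _)) // eq_sym. Qed.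

Lemma bas_crd (v : V) : v = \sum_i crd i v *: bas i.
Proof. exact/coord_vbasis/memvf. Qed.

Lemma scalarE (f : V -> C) : scalar f -> forall v, f v = \sum_i crd i v * f (bas i).
Proof.
move=> f_lin v; have f0 : f 0 = 0.
  by have := f_lin (-1) 0 0; rewrite scaler0 addr0 mulN1r addNr.
rewrite {1}(bas_crd v).
elim: (index_enum _) => [|i r IHr]; first by rewrite !big_nil.
by rewrite !big_cons f_lin IHr.
Qed.

Lemma linpolyP (a : C) (f g : V -> C) :
  linpoly (fun v => a * f v + g v) = a *: linpoly f + linpoly g.
Proof.
rewrite /linpoly scaler_sumr -big_split; apply: eq_bigr => i _.
by rewrite scalerDl scalerA.
Qed.

Lemma linpoly_crd i : linpoly (@crd C V i) = 'X_i.
Proof.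
rewrite /linpoly (bigD1 i) //= crd_bas eqxx scale1r big1 ?addr0 // => j ji.
by rewrite crd_bas eq_sym (negPf ji) scale0r.
Qed.

Lemma eq_linpoly (f g : V -> C) : f =1 g -> linpoly f = linpoly g.
Proof. by move=> fg; apply: eq_bigr => i _; rewrite fg. Qed.

Lemma linpoly_eq0 (f : V -> C) : scalar f -> linpoly f = 0 -> forall v, f v = 0.
Proof.
move=> f_lin f0 v; rewrite scalarE // big1 // => i _.
have := congr1 (mcoeff U_(i)) f0; rewrite mcoeff0 /linpoly raddf_sum /=.
rewrite (bigD1 i) //= big1 => [|j ji]; rewrite mcoeffZ mcoeffXU ?eqxx.
  by rewrite addr0 mulr1 => ->; rewrite mulr0.
by rewrite (negPf ji) mulr0.
Qed.

Lemma gact_linear (g : 'End(V)) a p q :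
  gact g (a *: p + q) = a *: gact g p + gact g q.
Proof. exact: linearP. Qed.

Lemma gactM (g : 'End(V)) p q : gact g (p * q) = gact g p * gact g q.
Proof. exact: rmorphM. Qed.

Lemma gact1 (g : 'End(V)) : gact g 1 = 1.
Proof. exact: rmorph1. Qed.

Lemma gactX (g : 'End(V)) i : gact g 'X_i = linpoly (fun v => crd i ((g^-1)%VF v)).
Proof. by rewrite /gact comp_mpolyXU -tnth_nth tnth_mktuple. Qed.

Lemma gact_sum (g : 'End(V)) (I : Type) (r : seq I) (F : I -> P) :
  gact g (\sum_(i <- r) F i) = \sum_(i <- r) gact g (F i).
Proof. exact: raddf_sum. Qed.

Lemma gactZ (g : 'End(V)) a p : gact g (a *: p) = a *: gact g p.
Proof. exact: linearZ. Qed.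

Lemma gact_linpoly (g : 'End(V)) (f : V -> C) : scalar f ->
  gact g (linpoly f) = linpoly (fun v => f ((g^-1)%VF v)).
Proof.
move=> f_lin; rewrite {1}/linpoly gact_sum.
under eq_bigr => i _ do rewrite gactZ gactX scaler_sumr.
rewrite exchange_big; apply: eq_bigr => j _ /=.
rewrite [X in X *: _](scalarE f_lin) scaler_suml.
by apply: eq_bigr => i _; rewrite scalerA mulrC.
Qed.

Lemma gact_id p : gact (V := V) \1%VF p = p.
Proof.
elim/mpoly_ind_X: p => [|a p q IHp IHq|i p IHp]; first exact: gact1.
  by rewrite gact_linear IHp IHq.
rewrite gactM IHp gactX -[in RHS]linpoly_crd; congr (_ * _); apply: eq_linpoly => v.
congr (coord _ _ _); rewrite -{1}[v]id_lfunE lker0_lfunK //.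
by apply/lker0P => x y; rewrite !id_lfunE.
Qed.

End LinearSubstitution.
Section FiniteUnitaryGroup.
Variables (C : numClosedFieldType) (V : vectType C) (ip : V -> V -> C).
Variable G : {fset 'End(V)}.
Local Notation P := {mpoly C[dimV V]}.
Hypothesis ip_inner : inner_product ip.
Hypothesis G_group : unitary_subgroup ip [set` G].

Lemma ip_scalar x : scalar (ip x).
Proof. by move=> a y z; apply: (ip_linear ip_inner). Qed.

Lemma ip0r x : ip x 0 = 0.
Proof. by have := ip_scalar x (-1) 0 0; rewrite scaler0 addr0 mulN1r addNr. Qed.

Lemma ipBr x y z : ip x (y - z) = ip x y - ip x z.
Proof. by rewrite addrC -scaleN1r ip_scalar mulN1r addrC. Qed.

Lemma ip_linearl a x y z : ip (a *: x + y) z = a^* * ip x z + ip y z.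
Proof.
by rewrite !(ip_conj ip_inner z) (ip_linear ip_inner) rmorphD rmorphM.
Qed.

Lemma ipBl x y z : ip (x - y) z = ip x z - ip y z.
Proof. by rewrite addrC -scaleN1r ip_linearl rmorphN1 mulN1r addrC. Qed.

Lemma ip_nondeg x : (forall y, ip x y = 0) -> x = 0.
Proof.
move=> x0; apply/eqP/negPn/negP => /(ip_pos ip_inner).
by rewrite x0 ltxx.
Qed.

Lemma group_unitary g x y : g \in G -> ip (g x) (g y) = ip x y.
Proof. by case: G_group => U _ _ _ /U. Qed.

Lemma group_id : \1%VF \in G. Proof. by case: G_group. Qed.

Lemma group_comp g h : g \in G -> h \in G -> (g \o h)%VF \in G.
Proof. by case: G_group => _ _ M _; apply: M. Qed.

Lemma group_inv g : g \in G -> (g^-1)%VF \in G.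
Proof. by case: G_group => _ _ _; apply. Qed.

(** An isometry of a definite form is injective. This makes [g^-1], in general only a
    pseudo-inverse, an actual two-sided inverse on G. *)
Lemma group_lker0 g : g \in G -> lker g == 0%VS.
Proof.
move=> gG; apply/lker0P => x y gxy; apply/eqP; rewrite -subr_eq0; apply/eqP.
apply: ip_nondeg => z; rewrite -(group_unitary (x - y) z gG).
have -> : g (x - y) = 0 by rewrite linearB /= gxy subrr.
by rewrite (ip_conj ip_inner) ip0r rmorph0.
Qed.

Lemma groupK g : g \in G -> cancel g (g^-1)%VF.
Proof. by move=> /group_lker0/lker0_lfunK. Qed.

Lemma groupVK g : g \in G -> cancel (g^-1)%VF g.
Proof. by move=> /group_lker0/lker0_lfunVK. Qed.

Lemma group_invM g h : g \in G -> h \in G -> ((g \o h)^-1 = h^-1 \o g^-1)%VF.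
Proof.
move=> gG hG; apply/lfunP => v; apply: (can_inj (groupK (group_comp gG hG))).
by rewrite groupVK ?group_comp // !comp_lfunE groupVK ?groupVK.
Qed.

Lemma group_invV g : g \in G -> ((g^-1)^-1)%VF = g.
Proof.
move=> gG; apply/lfunP => v; apply: (can_inj (groupK (group_inv gG))).
by rewrite groupVK ?group_inv // groupK.
Qed.

Lemma group_adjoint g x y : g \in G -> ip x ((g^-1)%VF y) = ip (g x) y.
Proof. by move=> gG; rewrite -(group_unitary _ _ gG) groupVK. Qed.

Lemma gact_comp g h (p : P) : g \in G -> h \in G ->
  gact (g \o h)%VF p = gact g (gact h p).
Proof.
move=> gG hG; elim/mpoly_ind_X: p => [|a p q IHp IHq|i p IHp].
- by rewrite !gact1.
- by rewrite !gact_linear IHp IHq.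
rewrite !gactM IHp !gactX gact_linpoly; last first.
  by move=> a x y; rewrite linearP crd_lin.
by congr (_ * _); apply: eq_linpoly => v; rewrite group_invM // comp_lfunE.
Qed.

Lemma gactVK g : g \in G -> cancel (@gact C V (g^-1)%VF) (gact g).
Proof.
move=> gG p; rewrite -gact_comp ?group_inv //.
by rewrite lker0_compfV ?group_lker0 // gact_id.
Qed.

Lemma gactK g : g \in G -> cancel (gact g) (@gact C V (g^-1)%VF).
Proof.
move=> gG p; rewrite -gact_comp ?group_inv //.
by rewrite lker0_compVf ?group_lker0 // gact_id.
Qed.

Lemma big_fset_bij (I : choiceType) (W : Type) (idx : W)
    (op : Monoid.com_law idx) (A B : {fset I}) (h : I -> I) (F : I -> W) :
  {in A &, injective h} -> (forall y, (y \in B) = (y \in [seq h x | x <- A])) ->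
  \big[op/idx]_(x <- B) F x = \big[op/idx]_(x <- A) F (h x).
Proof.
move=> h_inj hB; rewrite -(big_map h xpredT); apply: perm_big.
by apply: uniq_perm => //; rewrite map_inj_in_uniq // fset_uniq.
Qed.

(** Stated for any commutative law because two are needed: products show that determinants are roots
    of unity, sums that nontrivial characters sum to zero. *)
Lemma big_group_mul (W : Type) (idx : W) (op : Monoid.com_law idx)
    (F : 'End(V) -> W) h : h \in G ->
  \big[op/idx]_(g <- G) F g = \big[op/idx]_(g <- G) F (h \o g)%VF.
Proof.
move=> hG; apply: (@big_fset_bij _ _ _ _ _ _ (fun g => h \o g)%VF) => [g g' _ _|g].
  by move/(congr1 (fun f => h^-1 \o f)%VF); rewrite !lker0_compKf ?group_lker0.
apply/idP/mapP => [gG|[g' g'G ->]]; last by rewrite !group_comp.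
exists (h^-1 \o g)%VF; first by rewrite !group_comp ?group_inv.
by rewrite lker0_compVKf // group_lker0.
Qed.

Lemma group_conjK h : h \in G ->
  cancel (fun g => h \o g \o h^-1)%VF (fun g => h^-1 \o g \o h)%VF.
Proof.
by move=> hG g; apply/lfunP => v; rewrite !comp_lfunE groupK // groupK.
Qed.

Lemma group_conjVK h : h \in G ->
  cancel (fun g => h^-1 \o g \o h)%VF (fun g => h \o g \o h^-1)%VF.
Proof.
by move=> hG g; apply/lfunP => v; rewrite !comp_lfunE groupVK // groupVK.
Qed.

Lemma big_group_conj (W : nmodType) (F : 'End(V) -> W) h : h \in G ->
  \sum_(g <- G) F g = \sum_(g <- G) F (h \o g \o h^-1)%VF.
Proof.
move=> hG; apply: (@big_fset_bij _ _ _ _ _ _ (fun g => h \o g \o h^-1)%VF)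
  => [g g' _ _|g].
  exact/(can_inj (group_conjK hG)).
apply/idP/mapP => [gG|[g' g'G ->]]; last by rewrite !group_comp ?group_inv.
exists (h^-1 \o g \o h)%VF; first by rewrite !group_comp ?group_inv.
by rewrite [RHS](group_conjVK hG).
Qed.

Lemma big_group_inv (W : nmodType) (F : 'End(V) -> W) :
  \sum_(g <- G) F g = \sum_(g <- G) F (g^-1)%VF.
Proof.
apply: big_fset_bij => [g g' gG g'G gg'|g].
  by rewrite -(group_invV gG) gg' group_invV.
apply/idP/mapP => [gG|[g' g'G ->]]; last by rewrite group_inv.
by exists (g^-1)%VF; rewrite ?group_inv ?group_invV.
Qed.


Lemma ip_suml (I : Type) (r : seq I) (a : I -> C) (F : I -> V) y :
  ip (\sum_(i <- r) a i *: F i) y = \sum_(i <- r) (a i)^* * ip (F i) y.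
Proof.
elim: r => [|i r IHr]; first by rewrite !big_nil (ip_conj ip_inner) ip0r rmorph0.
by rewrite !big_cons ip_linearl IHr.
Qed.

(** The Gram matrix M of the basis is invertible: a row u with u M = 0 is the conjugate of the
    coordinate row of a vector orthogonal to everything. Coordinates get conjugated because [ip] is
    antilinear on the left. *)
Lemma riesz (f : V -> C) : scalar f -> exists x, forall v, ip x v = f v.
Proof.
move=> f_lin; pose M := \matrix_(i, j) ip (bas i) (bas j : V).
have Munit : M \in unitmx.
  rewrite -row_free_unit -kermx_eq0; apply/rowV0P => u /sub_kermxP uM.
  pose y := \sum_j (u 0 j)^* *: (bas j : V).
  have y0 : y = 0.
    apply: ip_nondeg => z; rewrite (scalarE (ip_scalar y)) big1 // => i _.
    suff -> : ip y (bas i) = 0 by rewrite mulr0.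
    have := congr1 (fun A : 'rV_(dimV V) => A 0 i) uM; rewrite !mxE => <-.
    by rewrite ip_suml; apply: eq_bigr => j _; rewrite mxE conjCK.
  apply/rowP => j; rewrite mxE -[LHS]conjCK.
  have -> : (u 0 j)^* = crd j y; last by rewrite y0 /crd linear0 rmorph0.
  rewrite /crd /y linear_sum (bigD1 j) //= big1 => [|i ij]; rewrite linearZ /=.
    by rewrite addr0 -[coord _ _ _]/(crd j (bas j)) crd_bas eqxx mulr1.
  by rewrite -[coord _ _ _]/(crd j (bas i)) crd_bas eq_sym (negPf ij) mulr0.
pose u := (\row_j f (bas j)) *m invmx M.
exists (\sum_i (u 0 i)^* *: bas i) => v; rewrite ip_suml (scalarE f_lin).
under eq_bigr => i _ do rewrite conjCK (scalarE (ip_scalar _)) mulr_sumr.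
rewrite exchange_big; apply: eq_bigr => j _ /=.
have -> : f (bas j) = (u *m M) 0 j by rewrite mulmxKV // mxE.
rewrite mxE mulr_sumr; apply: eq_bigr => i _.
by rewrite [M _ _]mxE mulrCA.
Qed.

(** Induction adapted to the pairing, whose adjunction rule concerns the forms [ip x] rather than
    the coordinates. *)
Lemma mpoly_ind_ip (Q : P -> Prop) :
  Q 1 -> (forall a p q, Q p -> Q q -> Q (a *: p + q)) ->
  (forall x p, Q p -> Q (linpoly (ip x) * p)) -> forall p, Q p.
Proof.
move=> Q1 QD QM; apply: mpoly_ind_X => // i p Qp.
have [x xE] := riesz (@crd_lin C V i).
by rewrite -linpoly_crd -(eq_linpoly xE); apply: QM.
Qed.

End FiniteUnitaryGroup.

(** * Homogeneous components and the value at 0 *)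

Section Homogeneity.
Variables (C : numClosedFieldType) (V : vectType C).
Local Notation P := {mpoly C[dimV V]}.

Lemma mnm_ind n (Q : 'X_{1..n} -> Prop) :
  Q 0%MM -> (forall i m, Q m -> Q (U_(i) + m)%MM) -> forall m, Q m.
Proof.
move=> Q0 QU m; have [d] := ubnP (mdeg m); elim: d => // d IHd in m *.
have [->//|m0] := eqVneq m 0%MM.
have [i mi] : exists i : 'I_n, (0 < m i)%N.
  case: (pickP (fun i => 0 < m i)%N) => [i mi|m_eq0]; first by exists i.
  by case/eqP: m0; apply/mnmP => i; rewrite mnmE; have := m_eq0 i; case: (m i).
have [m' ->] : exists m', m = (U_(i) + m')%MM.
  by exists (m - U_(i))%MM; rewrite addmC submK // lep1mP -lt0n.
by rewrite mdegD mdeg1 add1n ltnS => dm; apply/QU/IHd.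
Qed.

Lemma linpoly_homog (f : V -> C) : linpoly f \is 1.-homog.
Proof.
by rewrite /linpoly; apply: rpred_sum => i _; rewrite rpredZ // dhomogX /= mdeg1.
Qed.

Lemma homog_ind (d : nat) (Q : P -> Prop) : Q 0 ->
  (forall a p q, Q p -> Q q -> Q (a *: p + q)) ->
  (forall m, mdeg m = d -> Q 'X_[m]) -> forall p, p \is d.-homog -> Q p.
Proof.
move=> Q0 QD QX p /dhomogP ph; rewrite (mpolyE p).
rewrite big_seq; apply: big_rec => // m q /ph dm Qq.
by apply: QD => //; apply: QX.
Qed.

Lemma gact_homog (g : 'End(V)) d p : p \is d.-homog -> gact g p \is d.-homog.
Proof.
apply: (@homog_ind d (fun q => gact g q \is d.-homog)) => [|a q r qd rd|m];
  first by rewrite /gact comp_mpoly0 rpred0.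
  by rewrite gact_linear rpredD // rpredZ.
move: m d; elim/mnm_ind => [|i m IHm] d.
  by rewrite mdeg0 mpolyX0 gact1 => <-; apply: dhomog1.
rewrite mdegD mdeg1 mpolyXD gactM gactX => <-.
by apply: dhomogM; [apply: linpoly_homog | apply: IHm].
Qed.

Lemma linpoly_meval0 (f : V -> C) : (linpoly f).@[fun=> 0] = 0.
Proof.
by rewrite /linpoly raddf_sum big1 //= => i _; rewrite mevalZ mevalXU mulr0.
Qed.

Lemma gact_meval0 (g : 'End(V)) (p : P) : (gact g p).@[fun=> 0] = p.@[fun=> 0].
Proof.
elim/mpoly_ind_X: p => [|a p q IHp IHq|i p IHp]; first by rewrite gact1.
  by rewrite gact_linear !mevalD !mevalZ IHp IHq.
by rewrite gactM gactX !mevalM linpoly_meval0 mevalXU !mul0r.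
Qed.

Lemma pihomog0E (p : P) : pihomog mdeg 0 p = p.@[fun=> 0] *: 1.
Proof.
elim/mpolyind: p => [|a m p _ _ IHp]; first by rewrite pihomog0 meval0 scale0r.
rewrite linearP /= mevalD mevalZ IHp scalerDl -scalerA; congr (_ *: _ + _).
elim/mnm_ind: m => [|i m IHm].
  by rewrite mpolyX0 meval1 scale1r pihomog_dE // dhomog1.
by rewrite pihomogX /= mdegD mdeg1 mpolyXD mevalM mevalXU mul0r scale0r.
Qed.

End Homogeneity.

(** * Consequences of the commutation relation *)

(* The algebra of the operators only enters through the relation [opX], in which
   the reflection hyperplanes no longer appear. *)
Section CherednikRelations.
Variables (C : numClosedFieldType) (V : vectType C) (ip : V -> V -> C).
Variable G : {fset 'End(V)}.
Local Notation P := {mpoly C[dimV V]}.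
Hypothesis ip_inner : inner_product ip.
Hypothesis G_group : unitary_subgroup ip [set` G].

Variables (c : 'End(V) -> C) (T : V -> P -> P).
Hypothesis op_linear : forall x a p q, T x (a *: p + q) = a *: T x p + T x q.
Hypothesis op_vec : forall a x y p, T (a *: x + y) p = a *: T x p + T y p.
Hypothesis op1 : forall x, T x 1 = 0.
Hypothesis opX : forall x i p, T x ('X_i * p) = 'X_i * T x p + crd i x *: p
  + \sum_(g <- G) (c g * crd i ((g^-1)%VF x - x)) *: gact g p.
Hypothesis c_conj : forall g h, g \in G -> h \in G -> c (h \o g \o h^-1)%VF = c g.
Hypothesis c_inv : forall g, g \in G -> c (g^-1)%VF = (c g)^*.
Hypothesis c_rank1 : forall g, g \in G -> c g != 0 ->
  exists (f : V -> C) (y : V), forall v, (g^-1)%VF v - v = f v *: y.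

Lemma op0 x : T x 0 = 0.
Proof. by rewrite -{1}(addNr 1) -scaleN1r op_linear op1 scaler0 addr0. Qed.

Lemma opZ x a p : T x (a *: p) = a *: T x p.
Proof. by rewrite -[a *: p]addr0 op_linear op0 addr0. Qed.

Lemma opD x p q : T x (p + q) = T x p + T x q.
Proof. by rewrite -{1}[p]scale1r op_linear scale1r. Qed.

Lemma op_sum x (I : Type) (r : seq I) (F : I -> P) :
  T x (\sum_(i <- r) F i) = \sum_(i <- r) T x (F i).
Proof.
elim: r => [|i r IHr]; first by rewrite !big_nil op0.
by rewrite !big_cons opD IHr.
Qed.

Lemma op_linpoly x (f : V -> C) p : scalar f ->
  T x (linpoly f * p) = linpoly f * T x p + f x *: p
    + \sum_(g <- G) (c g * f ((g^-1)%VF x - x)) *: gact g p.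
Proof.
move=> f_lin; rewrite /linpoly mulr_suml op_sum.
under eq_bigr => i _ do rewrite -scalerAl opZ opX !scalerDr.
rewrite !big_split /=; congr (_ + _ + _).
- by rewrite mulr_suml; apply: eq_bigr => i _; rewrite scalerAl.
- rewrite (scalarE f_lin) scaler_suml; apply: eq_bigr => i _.
  by rewrite scalerA mulrC.
under eq_bigr => i _ do rewrite scaler_sumr.
rewrite exchange_big; apply: eq_bigr => g _ /=.
rewrite (scalarE f_lin) mulr_sumr scaler_suml; apply: eq_bigr => i _.
by rewrite scalerA mulrC mulrA.
Qed.

Lemma op_equivariant h x p : h \in G -> gact h (T x p) = T (h x) (gact h p).
Proof.
move=> hG; elim/mpoly_ind_X: p => [|a p q IHp IHq|i p IHp].
- by rewrite gact1 !op1 /gact comp_mpoly0.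
- by rewrite !(op_linear, gact_linear) IHp IHq.
rewrite opX !gactM gactX op_linpoly; last by move=> a u v; rewrite linearP crd_lin.
rewrite [LHS]raddfD [X in X + _]raddfD /= -![comp_mpoly _ _]/(gact h _) gactM gactX.
rewrite gactZ IHp (groupK ip_inner G_group) //; congr (_ + _).
(* Substituting h g h^-1 for g matches the group terms at [h x] with the images under h of those at
   x, since c is invariant under conjugation. *)
rewrite gact_sum [RHS](big_group_conj ip_inner G_group _ hG).
apply: eq_big_seq => g gG; rewrite gactZ (c_conj gG hG).
have hV := group_inv G_group hG; have hg := group_comp G_group hG gG.
rewrite (gact_comp ip_inner G_group _ hg hV) (gact_comp ip_inner G_group _ hG gG).
rewrite (gactK ip_inner G_group hG); congr ((_ * crd i _) *: _).
rewrite (group_invM ip_inner G_group hg hV) (group_invM ip_inner G_group hG gG).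
rewrite (group_invV ip_inner G_group hG) linearB /=.
by rewrite !comp_lfunE !(groupK ip_inner G_group hG).
Qed.

Lemma op_comm x y p : T x (T y p) = T y (T x p).
Proof.
elim/mpoly_ind_X: p => [|a p q IHp IHq|i p IHp]; first by rewrite !op1 !op0.
  by rewrite !op_linear IHp IHq.
rewrite !opX !opD !opX !opZ !op_sum IHp -!addrA; congr (_ + _).
(* The terms a and b occur on both sides; only the group sums remain, and they are compared one g at
   a time. *)
set a := _ *: T y p; set b := _ *: T x p; set s1 := \sum_(g <- G) _.
set s2 := \sum_(g <- G) _; set s3 := \sum_(g <- G) _; set s4 := \sum_(g <- G) _.
rewrite (addrCA s1) (addrCA s3) [RHS]addrCA; congr (_ + (_ + _)).
rewrite -!big_split; apply: eq_big_seq => g gG /=; rewrite !opZ.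
have [-> | cg0] := eqVneq (c g) 0; first by rewrite !mul0r !scale0r.
(* Writing g^-1 v - v = f(v) u gives T_{g v} = T_v - f(v) T_{g u}. After equivariance, the only
   product term carries f(x) f(y), which is symmetric in x and y. *)
have [f [u fu]] := c_rank1 gG cg0.
have gE v q : T (g v) q = T v q - f v *: T (g u) q.
  have -> : g v = (- f v) *: g u + v.
    rewrite scaleNr -[f v *: _]linearZ -fu linearB /=.
    by rewrite (groupVK ip_inner G_group) // opprB subrK.
  by rewrite op_vec scaleNr addrC.
have crdE v : c g * crd i ((g^-1)%VF v - v) = f v * (c g * crd i u).
  by rewrite fu /crd linearZ mulrCA.
rewrite !op_equivariant // (gE x) (gE y) !crdE !scalerBr !scalerA.
set k := c g * crd i u; rewrite [in RHS]mulrAC [f x * k * f y]mulrAC.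
by rewrite (mulrC (f y) (f x)) addrAC [RHS]addrAC (addrC (_ *: T y _)).
Qed.

Lemma op_homog x d p : p \is d.+1.-homog -> T x p \is d.-homog.
Proof.
apply: (@homog_ind _ _ _ (fun q => T x q \is d.-homog)) => [|a q r qd rd|m].
- by rewrite op0 rpred0.
- by rewrite op_linear rpredD // rpredZ.
move: m d; elim/mnm_ind => [|i m IHm] d; first by rewrite mdeg0.
rewrite mdegD mdeg1 add1n => -[dm]; rewrite mpolyXD opX.
have Xd : 'X_[C, m] \is d.-homog by rewrite dhomogX /= dm.
rewrite !rpredD ?rpredZ //; last first.
  by rewrite rpred_sum // => g _; rewrite rpredZ // gact_homog.
(* For d = 0 the induction hypothesis says nothing, but then the monomial is 1 and is killed by
   T. *)
case: d dm {Xd} => [|d] dm; last first.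
  by rewrite -add1n dhomogM ?IHm // dhomogX /= mdeg1.
by move/eqP: dm; rewrite mdeg_eq0 => /eqP->; rewrite mpolyX0 op1 mulr0 rpred0.
Qed.

Definition euler p := \sum_i 'X_i * T (bas i) p - \sum_(g <- G) c g *: (gact g p - p).

Lemma euler_linear a p q : euler (a *: p + q) = a *: euler p + euler q.
Proof.
rewrite /euler scalerBr addrACA -opprD !scaler_sumr -!big_split /=.
congr (_ - _); apply: eq_bigr => i _; first by rewrite op_linear mulrDr -scalerAr.
by rewrite gact_linear opprD addrACA scalerDr -scalerBr scalerA mulrC -scalerA.
Qed.

(** Summed over the basis, the group terms produced by [opX] become c_g (g x_i - x_i) g p. This is
    also the commutator of c_g (g - 1) with x_i applied to p, so the subtraction in [euler] cancels
    them. *)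
Lemma eulerX i p : euler ('X_i * p) = 'X_i * euler p + 'X_i * p.
Proof.
rewrite /euler; under eq_bigr => j _ do rewrite opX !mulrDr.
rewrite !big_split /= mulrBr mulr_sumr -!addrA.
congr (_ + _); first by apply: eq_bigr => j _; rewrite mulrCA.
rewrite [RHS]addrC; congr (_ + _).
  rewrite (bigD1 i) //= crd_bas eqxx scale1r big1 ?addr0 // => j ji.
  by rewrite crd_bas eq_sym (negPf ji) scale0r mulr0.
under eq_bigr => j _ do rewrite mulr_sumr.
rewrite exchange_big /= mulr_sumr -sumrB -sumrN; apply: eq_bigr => g _ /=.
under eq_bigr => j _ do rewrite -scalerAr -scalerA scalerAl.
rewrite -scaler_sumr -mulr_suml.
rewrite gactM gactX.
have -> : linpoly (fun v => crd i ((g^-1)%VF v)) =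
    'X_i + \sum_j crd i ((g^-1)%VF (bas j) - bas j) *: 'X_j.
  rewrite -linpoly_crd /linpoly -big_split; apply: eq_bigr => j _ /=.
  by rewrite -scalerDl /crd linearB /= addrC subrK.
rewrite -scalerAr -scalerBr -scalerN; congr (_ *: _).
by rewrite mulrDl mulrBr !opprB opprD addrC !addrA subrK.
Qed.

Lemma euler_homog d p : p \is d.-homog -> euler p = d%:R *: p.
Proof.
have euler0 : euler 0 = 0.
  by rewrite -[0 in LHS](addNr 1) -scaleN1r euler_linear scaleN1r addNr.
apply: (@homog_ind _ _ _ (fun q => euler q = d%:R *: q)) => [|a q r Eq Er|m].
- by rewrite euler0 scaler0.
- by rewrite euler_linear Eq Er scalerDr !scalerA mulrC.
move: m d; elim/mnm_ind => [|i m IHm] d.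
  rewrite mdeg0 mpolyX0 => <-; rewrite scale0r /euler.
  rewrite !big1 ?subr0 // => [g _|i _]; last by rewrite op1 mulr0.
  by rewrite gact1 subrr scaler0.
rewrite mdegD mdeg1 add1n mpolyXD => <-.
by rewrite eulerX (IHm _ erefl) -scalerAr -{2}['X_i * _]scale1r -scalerDl -mulrSr.
Qed.

(** The submodule condition tested on generators only, with complex scalars made explicit;
    [stable_submodule] gives the equivalence. *)
Definition stable (N : set P) := [/\ N 0,
  forall a p q, N p -> N q -> N (a *: p + q),
  forall i p, N p -> N ('X_i * p),
  forall x p, N p -> N (T x p) &
  forall g p, g \in G -> N p -> N (gact g p)].

(** * Stable subspaces are graded *)

Section StableSubspace.
Variable N : set P.
Hypothesis N_stable : stable N.

Lemma stable0 : N 0. Proof. by case: N_stable. Qed.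

Lemma stable_lin a p q : N p -> N q -> N (a *: p + q).
Proof. by case: N_stable => _ + _ _ _; apply. Qed.

Lemma stableZ a p : N p -> N (a *: p).
Proof. by move=> Np; rewrite -[_ *: _]addr0; apply/stable_lin/stable0. Qed.

Lemma stableD p q : N p -> N q -> N (p + q).
Proof. by move=> Np Nq; rewrite -[p]scale1r; apply: stable_lin. Qed.

Lemma stableB p q : N p -> N q -> N (p - q).
Proof. by move=> Np Nq; rewrite addrC -scaleN1r; apply: stable_lin. Qed.

Lemma stable_sum (I : eqType) (r : seq I) (F : I -> P) :
  (forall i, i \in r -> N (F i)) -> N (\sum_(i <- r) F i).
Proof.
move=> NF; rewrite big_seq.
by apply: big_ind => //; [exact: stable0 | exact: stableD].
Qed.

Lemma stable_euler p : N p -> N (euler p).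
Proof.
case: N_stable => _ _ NX NT NG Np; apply: stableB; apply: stable_sum => i iG.
  exact/NX/NT.
by apply/stableZ/stableB => //; apply: NG.
Qed.

(* Interpolation: [W r] kills the components of degree in [r] and only rescales
   the other ones. *)
Lemma stable_pihomog d p : N p -> N (pihomog mdeg d p).
Proof.
move=> Np; pose W := foldr (fun (e : nat) q => - e%:R *: q + euler q) p.
have NW r : N (W r).
  by elim: r => //= e r IHr; apply: stable_lin => //; apply: stable_euler.
(* The bound exceeds d as well as every degree in p, so that d indexes a term of the decomposition
   even when d is beyond the degree of p. *)
have [k dk pk] : exists2 k, (d < k)%N & (msize p <= k)%N.
  by exists (maxn d.+1 (msize p)); rewrite leq_max leqnn ?orbT.
have eulerS (I : Type) (r : seq I) (F : I -> P) :
    euler (\sum_(i <- r) F i) = \sum_(i <- r) euler (F i).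
  elim: r => [|i r IHr].
    by rewrite !big_nil -[0 in LHS](addNr 1) -scaleN1r euler_linear scaleN1r addNr.
  by rewrite !big_cons -[F i]scale1r euler_linear IHr !scale1r.
have WE r : W r = \sum_(j < k) (\prod_(e <- r) (j%:R - e%:R)) *: pihomog mdeg j p.
  elim: r => [|e r IHr] /=.
    rewrite {1}(pihomog_partitionE pk); apply: eq_bigr => j _.
    by rewrite big_nil scale1r.
  rewrite IHr eulerS scaler_sumr -big_split; apply: eq_bigr => j _ /=.
  rewrite (euler_homog (d := j)) ?rpredZ ?pihomogP // -scalerDl scalerA big_cons.
  by rewrite addrC.
(* Removing all degrees but d leaves the component of degree d times a product of nonzero integers d
   - e, which is then divided out. *)
pose r := [seq e <- iota 0 k | e != d].
have := NW r; rewrite WE (bigD1 (Ordinal dk)) //= [X in _ + X]big1 => [|j jd].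
  rewrite addr0 => /(stableZ (\prod_(e <- r) (d%:R - e%:R))^-1).
  rewrite scalerA mulVf ?scale1r // prodf_seq_neq0; apply/allP => e.
  by rewrite mem_filter => /andP[ed _]; rewrite subr_eq0 eqr_nat eq_sym.
rewrite (big_rem (j : nat)) /= ?subrr ?mul0r ?scale0r //.
rewrite -val_eqE /= in jd.
by rewrite mem_filter jd mem_iota ltn_ord.
Qed.

(** By gradedness the constant term of p lies in N; a nonzero one could be rescaled to 1. *)
Lemma stable_meval0 p : ~ N 1 -> N p -> p.@[fun=> 0] = 0.
Proof.
move=> N1 /(stable_pihomog 0); rewrite pihomog0E => Np0.
apply/eqP/negPn/negP => p0; apply: N1.
by have := stableZ (p.@[fun=> 0])^-1 Np0; rewrite scalerA mulVf ?scale1r.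
Qed.

End StableSubspace.

(** * Contravariant forms and their radicals *)

Section ContravariantForm.
Variable B : P -> P -> C.
Hypothesis form_linearl : forall a p q r, B (a *: p + q) r = a^* * B p r + B q r.
Hypothesis form_linearr : forall a p q r, B r (a *: p + q) = a * B r p + B r q.
Hypothesis form1 : forall q, B 1 q = q.@[fun=> 0].
Hypothesis formM : forall x p q, B (linpoly (ip x) * p) q = B p (T x q).

Lemma form0l q : B 0 q = 0.
Proof.
by rewrite -(addNr 1) -scaleN1r form_linearl rmorphN rmorph1 mulN1r addNr.
Qed.

Lemma form0r p : B p 0 = 0.
Proof. by rewrite -(addNr 1) -scaleN1r form_linearr mulN1r addNr. Qed.

Lemma form_suml (I : Type) (r : seq I) (a : I -> C) (F : I -> P) q :
  B (\sum_(i <- r) a i *: F i) q = \sum_(i <- r) (a i)^* * B (F i) q.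
Proof.
elim: r => [|i r IHr]; first by rewrite !big_nil form0l.
by rewrite !big_cons form_linearl IHr.
Qed.

Lemma form_sumr (I : Type) (r : seq I) (a : I -> C) (F : I -> P) p :
  B p (\sum_(i <- r) a i *: F i) = \sum_(i <- r) a i * B p (F i).
Proof.
elim: r => [|i r IHr]; first by rewrite !big_nil form0r.
by rewrite !big_cons form_linearr IHr.
Qed.

(** The action of g sends the form [ip x] to [ip (g x)], which is moved across as T_{g x};
    equivariance turns this back into T_x. *)
Lemma form_invariant g p q : g \in G -> B (gact g p) (gact g q) = B p q.
Proof.
move=> gG; elim/(mpoly_ind_ip ip_inner): p q => [|a p p' IHp IHp'|x p IHp] q.
- by rewrite gact1 !form1 gact_meval0.
- by rewrite gact_linear !form_linearl IHp IHp'.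
rewrite gactM (gact_linpoly _ (ip_scalar ip_inner x)).
rewrite (eq_linpoly (fun v => group_adjoint ip_inner G_group x v gG)) !formM.
by rewrite -op_equivariant // IHp.
Qed.

Lemma form_gactr g p q : g \in G -> B p (gact g q) = B (gact (g^-1)%VF p) q.
Proof.
by move=> gG; rewrite -[RHS](form_invariant _ _ gG) (gactVK ip_inner G_group gG).
Qed.

(** The adjunction opposite to [formM]. For [ip y] times p, both sides expand by the commutation
    relation into three terms: the first agree by induction, the second because (y,x) and (x,y) are
    conjugate. *)
Lemma form_adjoint x p q : B (T x p) q = B p (linpoly (ip x) * q).
Proof.
elim/(mpoly_ind_ip ip_inner): p q => [|a p p' IHp IHp'|y p IHp] q.
- by rewrite op1 form0l form1 mevalM linpoly_meval0 mul0r.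
- by rewrite op_linear !form_linearl IHp IHp'.
rewrite formM !(op_linpoly _ _ (ip_scalar ip_inner _)).
rewrite -[linpoly _ * _ + _ + _]addrA -[X in X + _]scale1r form_linearl conjC1 mul1r.
rewrite formM IHp -[linpoly _ * _ + _ + _]addrA -[X in B _ (X + _)]scale1r.
rewrite form_linearr mul1r; congr (_ + _).
rewrite form_linearl form_linearr -(ip_conj ip_inner); congr (_ + _).
(* The third terms agree after replacing g by its inverse: g^-1 is the adjoint of g for both B and
   [ip], and [c_inv] supplies the conjugate coefficient. *)
rewrite form_suml form_sumr (big_group_inv ip_inner G_group).
apply: eq_big_seq => g gG.
rewrite (c_inv gG) rmorphM /= conjCK (form_gactr _ _ gG) -!mulrA; congr (_ * (_ * _)).
rewrite (group_invV ip_inner G_group gG) !(ipBr ip_inner) rmorphB /= -!(ip_conj ip_inner).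
by rewrite (group_adjoint ip_inner G_group _ _ gG).
Qed.

Lemma form1r p : B p 1 = (p.@[fun=> 0])^*.
Proof.
elim/(mpoly_ind_ip ip_inner): p => [|a p q IHp IHq|x p IHp].
- by rewrite form1 meval1 conjC1.
- by rewrite form_linearl IHp IHq mevalD mevalZ rmorphD rmorphM.
by rewrite formM op1 form0r mevalM linpoly_meval0 mul0r rmorph0.
Qed.

(** With both adjunctions, linear forms can be stripped from either argument until it is 1. The
    symmetry is what links the radical, defined through the left argument, to operators T acting on
    the right one. *)
Lemma form_hermitian p q : B q p = (B p q)^*.
Proof.
elim/(mpoly_ind_ip ip_inner): p q => [|a p p' IHp IHp'|x p IHp] q.
- by rewrite form1r form1.
- by rewrite form_linearl form_linearr IHp IHp' rmorphD rmorphM /= conjCK.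
by rewrite formM -IHp form_adjoint.
Qed.

Definition radical : set P := [set p | forall q, B p q = 0].

Lemma radical_stable : stable radical.
Proof.
have radM (x : V) p : radical p -> radical (linpoly (ip x) * p).
  by move=> rp q; rewrite formM.
split=> [q|a p q rp rq r|i p rp|x p rp q|g p gG rp q].
- exact: form0l.
- by rewrite form_linearl rp rq mulr0 addr0.
- have [x xE] := riesz ip_inner (@crd_lin C V i).
  by rewrite -linpoly_crd -(eq_linpoly xE); apply: radM.
- by rewrite form_adjoint.
- by rewrite -(gactVK ip_inner G_group gG q) form_invariant.
Qed.

Lemma radical1 : ~ radical 1.
Proof. by move=> /(_ 1); rewrite form1 meval1 => /eqP; rewrite oner_eq0. Qed.

Lemma form_stable N p q : stable N -> ~ N 1 -> N p -> B q p = 0.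
Proof.
move=> N_st N1; elim/(mpoly_ind_ip ip_inner): q p => [|a q r IHq IHr|x q IHq] p Np.
- by rewrite form1; apply: stable_meval0 Np.
- by rewrite form_linearl IHq // IHr // mulr0 addr0.
by rewrite formM IHq //; case: N_st => _ _ _ NT _; apply: NT.
Qed.

Lemma stable_sub_radical N : stable N -> ~ N 1 -> N `<=` radical.
Proof.
by move=> N_st N1 p Np q; rewrite form_hermitian (form_stable _ N_st N1 Np) rmorph0.
Qed.

Lemma radical_neq0P : (exists2 p, radical p & p != 0) <->
  exists (p : P) (d : nat),
    [/\ p != 0, (0 < d)%N, p \is d.-homog & forall x, T x p = 0].
Proof.
split=> [[p rp p0]|[p [d [p0 d0 pd Tp]]]].
  (* Since the radical is graded, some component of p is a nonzero homogeneous element of it; one of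
     least degree is then chosen. *)
  have homP : exists d, `[< exists2 q, radical q & q != 0 /\ q \is d.-homog >].
    have [d pd0] : exists d, pihomog mdeg d p != 0.
      apply: contrapT => /forallNP p_eq0; case/eqP: p0.
      rewrite (pihomog_partitionE (leqnn (msize p))) big1 // => i _.
      by have /negP := p_eq0 i; rewrite negbK => /eqP.
    exists d; apply/asboolP; exists (pihomog mdeg d p).
      exact: (stable_pihomog radical_stable).
    by rewrite pihomogP.
  case: (ex_minnP homP) => d /asboolP[q rq [q0 qd]] d_min.
  have d_gt0 : (0 < d)%N.
    rewrite lt0n; apply/eqP => d0; rewrite d0 in qd.
    have := stable_meval0 radical_stable radical1 rq => qv.
    by case/eqP: q0; rewrite -(pihomog_dE qd) pihomog0E qv scale0r.
  exists q, d; split=> // x; apply/eqP/negPn/negP => Tq0.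
  have /d_min : `[< exists2 r, radical r & r != 0 /\ r \is d.-1.-homog >].
    apply/asboolP; exists (T x q); last by rewrite Tq0 op_homog // prednK.
    by case: radical_stable => _ _ _ radT _; apply: radT.
  by rewrite -ltnS prednK // ltnn.
(* Conversely, a singular vector p is orthogonal to 1, having no constant term, and to every
   multiple of a linear form, because all T_x kill it. *)
exists p => // q; rewrite form_hermitian.
suff -> : B q p = 0 by rewrite rmorph0.
elim/(mpoly_ind_ip ip_inner): q => [|a q r IHq IHr|x q IHq].
- have := pihomog0E p; rewrite (pihomog_ne0 _ pd) ?gtn_eqF // form1 => /esym/eqP.
  by rewrite scaler_eq0 oner_eq0 orbF => /eqP.
- by rewrite form_linearl IHq IHr mulr0 addr0.
by rewrite formM Tp form0r.
Qed.

End ContravariantForm.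
End CherednikRelations.

(** * Dunkl operators *)

(** The matrix determinant lemma, from two block triangular factorizations of the same bordered
    matrix. *)
Lemma det_1D_mul n (C : comNzRingType) (u : 'cV[C]_n) (v : 'rV[C]_n) :
  \det (1%:M + u *m v) = 1 + (v *m u) 0 0.
Proof.
pose M := block_mx 1%:M (- v) u 1%:M.
have ML : M = block_mx 1%:M 0 u 1%:M *m block_mx 1%:M (- v) 0 (1%:M + u *m v).
  rewrite mulmx_block !mul1mx !mul0mx !mulmx1 !addr0 mulmxN.
  by rewrite addrCA addNr addr0.
have MU : M = block_mx 1%:M (- v) 0 1%:M *m block_mx (1%:M + v *m u) 0 u 1%:M.
  rewrite mulmx_block !mul1mx !mul0mx !mulmx1 !add0r mulNmx.
  by rewrite addrK.
have := congr1 determinant ML; rewrite MU !det_mulmx.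
rewrite !(det_lblock, det_ublock) !det1 !mul1r mulr1 => <-.
by rewrite {1}[_ + _]mx11_scalar det_scalar1 !mxE eqxx.
Qed.

Section Determinant.
Variables (C : numClosedFieldType) (V : vectType C).

Lemma detM (g h : 'End(V)) : det (g \o h)%VF = det g * det h.
Proof.
rewrite /det -det_mulmx; congr (\det _); apply/matrixP => i j; rewrite !mxE.
rewrite comp_lfunE (@scalarE _ _ (fun v => crd i (g v))); last first.
  by move=> a x y; rewrite linearP crd_lin.
by apply: eq_bigr => l _; rewrite !mxE mulrC.
Qed.

Lemma det_id : det (\1%VF : 'End(V)) = 1.
Proof.
rewrite /det -[RHS](det1 _ (dimV V)); congr (\det _); apply/matrixP => i j.
by rewrite !mxE id_lfunE crd_bas.
Qed.

Lemma det_rank1 (g : 'End(V)) (f : V -> C) (y : V) : scalar f ->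
  (forall v, g v - v = f v *: y) -> det g = 1 + f y.
Proof.
move=> f_lin gE; rewrite /det.
pose u : 'cV[C]_(dimV V) := \col_i crd i y; pose w : 'rV[C]_(dimV V) := \row_j f (bas j).
have -> : \matrix_(i, j) crd i (g (bas j)) = 1%:M + u *m w.
  apply/matrixP => i j; rewrite !mxE big_ord1 !mxE -[g _](subrK (bas j)) gE addrC.
  by rewrite /crd linearD linearZ /= -!/(crd _ _) crd_bas mulrC.
rewrite det_1D_mul mxE (scalarE f_lin y); congr (_ + _).
by apply: eq_bigr => i _; rewrite !mxE mulrC.
Qed.

End Determinant.

(** * Pointwise stabilizers and determinants *)

Section Stabilizer.
Variables (C : numClosedFieldType) (V : vectType C) (ip : V -> V -> C).
Variable G : {fset 'End(V)}.
Hypothesis ip_inner : inner_product ip.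
Hypothesis G_group : unitary_subgroup ip [set` G].

Lemma stabP (g : 'End(V)) (H : {vspace V}) :
  reflect (g \in G /\ {in H, forall v, g v = v}) (g \in stab G H).
Proof.
rewrite /stab !inE /=; apply: (iffP andP) => -[gG gH]; split=> //.
  move=> v /(subvP gH); rewrite memv_ker add_lfunE opp_lfunE id_lfunE subr_eq0.
  by move/eqP.
by apply/subvP => v /gH gv; rewrite memv_ker add_lfunE opp_lfunE id_lfunE gv subrr.
Qed.

Lemma stab_group H : unitary_subgroup ip [set` stab G H].
Proof.
split=> [g /= /stabP[gG _]|/=|g h /= /stabP[gG gH] /stabP[hG hH]|g /= /stabP[gG gH]].
- by move=> x y; exact: (group_unitary G_group).
- by apply/stabP; split; [apply: group_id G_group | move=> v _; rewrite id_lfunE].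
- apply/stabP; split; first exact: (group_comp G_group).
  by move=> v vH; rewrite comp_lfunE hH ?gH.
apply/stabP; split=> [|v vH]; first exact: (group_inv G_group).
by rewrite -{1}(gH v vH) (groupK ip_inner G_group).
Qed.

Lemma detV g : g \in G -> det (g^-1)%VF * det g = 1.
Proof.
by move=> gG; rewrite -detM lker0_compVf ?det_id // (group_lker0 ip_inner G_group).
Qed.

(** Translation by g permutes G, so the product of all determinants is unchanged when multiplied by
    det(g)^|G|. Hence det g is a root of unity, and its inverse is its conjugate. *)
Lemma det_conj_inv g : g \in G -> det (g^-1)%VF = (det g)^*.
Proof.
move=> gG; have dVg := detV gG.
have dg0 : det g != 0 by apply/eqP => d0; move/eqP: dVg; rewrite d0 mulr0 eq_sym oner_eq0.
have det_exp : det g ^+ #|` G| = 1.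
  have := @big_group_mul _ _ _ _ ip_inner G_group C 1 *%R (@det C V) g gG.
  under [RHS]eq_bigr => h _ do rewrite detM.
  rewrite big_split big_const_seq count_predT iter_mulr_1 /=.
  set D := \prod_(h <- G) _ => /esym/eqP; rewrite -subr_eq0 -{2}[D]mul1r -mulrBl mulf_eq0.
  rewrite subr_eq0 => /orP[/eqP //|D0].
  have : D != 0; last by rewrite D0.
  rewrite prodf_seq_neq0; apply/allP => h hG /=; apply/eqP => h0.
  by have /eqP := detV hG; rewrite h0 mulr0 eq_sym oner_eq0.
have norm1 : `|det g| = 1.
  apply/eqP; rewrite -(@pexpr_eq1 _ _ #|` G|) ?normr_ge0 // -?normrX ?det_exp ?normr1 //.
  by rewrite cardfs_gt0; apply/fset0Pn; exists g.
by apply: (mulIf dg0); rewrite dVg mulrC -normCK norm1 expr1n.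
Qed.

End Stabilizer.
Section DunklOperators.
Variables (C : numClosedFieldType) (V : vectType C) (ip : V -> V -> C).
Variables (G : {fset 'End(V)}) (alpha : {vspace V} -> 'Hom(V, C^o)).
Variable k : set {vspace V} -> nat -> C.
Local Notation P := {mpoly C[dimV V]}.
Local Notation refl := (reflection_hyperplane G).
Hypothesis ip_inner : inner_product ip.
Hypothesis G_group : unitary_subgroup ip [set` G].
Hypothesis alphaP : forall H, refl H -> lker (alpha H) = H.
Hypothesis k_real : forall O i, (k O i)^* = k O i.

Lemma alpha_scalar H : scalar (alpha H : V -> C).
Proof. by move=> a x y; rewrite linearP. Qed.

Lemma eH_neq0 H : (eH G H)%:R != 0 :> C.
Proof.
rewrite pnatr_eq0 -lt0n cardfs_gt0; apply/fset0Pn; exists \1%VF.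
exact: group_id (stab_group ip_inner G_group H).
Qed.

(** The coefficient of g in a_H(k), after e_H has cancelled against the normalization of
    [epsilon]. *)
Definition reflection_coeff H (g : 'End(V)) :=
  \sum_(1 <= i < eH G H) k (hyp_orbit G H) i * det g ^+ i.

Lemma aHE H p :
  aH G k H p = \sum_(g <- stab G H) reflection_coeff H g *: gact g p.
Proof.
rewrite /aH; under eq_bigr => i _.
  rewrite /epsilon scalerA mulrAC mulfV ?eH_neq0 // mul1r scaler_sumr.
  under eq_bigr => g _ do rewrite scalerA.
  over.
rewrite exchange_big; apply: eq_bigr => g _ /=.
by rewrite scaler_suml.
Qed.

Lemma aH_linear H a p q : aH G k H (a *: p + q) = a *: aH G k H p + aH G k H q.
Proof.
rewrite !aHE scaler_sumr -big_split; apply: eq_bigr => g _ /=.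
by rewrite gact_linear scalerDr !scalerA mulrC.
Qed.

Section Hyperplane.
Variable H : {vspace V}.
Hypothesis H_refl : refl H.

Lemma alpha_neq0 : exists v, alpha H v = 1.
Proof.
case: (pselect (exists v, alpha H v != 0)) => [[v av]|/forallNP a0].
  by exists ((alpha H v)^-1 *: v); rewrite linearZ /= [_ *: _]mulVf.
have : H = {:V}%VS.
  rewrite -(alphaP H_refl); apply/eqP; rewrite eqEsubv subvf; apply/subvP => v _.
  by rewrite memv_ker; have /negP := a0 v; rewrite negbK.
by case: H_refl => + _ HV; rewrite HV /is_hyperplane /dimV => /esym/n_Sn.
Qed.

(** The vector v - alpha_H(v) v0 lies in H, hence is fixed by g. *)
Lemma stab_rank1 g v v0 : g \in stab G H -> alpha H v0 = 1 ->
  g v - v = alpha H v *: (g v0 - v0).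
Proof.
move=> /stabP[_ gH] av0.
have : v - alpha H v *: v0 \in H.
  by rewrite -{2}(alphaP H_refl) memv_ker linearB linearZ /= av0 [_ *: _]mulr1 subrr.
move/gH; rewrite linearB linearZ /= => /eqP.
rewrite subr_eq => /eqP ->; rewrite scalerBr.
by rewrite addrC !addrA addNr add0r addrC.
Qed.

(** If g in G_H has determinant 1, then g v - v = alpha_H(v) y with alpha_H(y) = 0, so g fixes y.
    Comparing (g v, g y) with (v, y) gives alpha_H(v) = 0 or y = 0: a unitary transvection is
    trivial. *)
Lemma det_stab_inj : {in stab G H &, injective (@det C V)}.
Proof.
have det1_id g : g \in stab G H -> det g = 1 -> g = \1%VF.
  move=> gS; have [v0 av0] := alpha_neq0; set y := g v0 - v0.
  have gE v : g v - v = alpha H v *: y by apply: stab_rank1.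
  rewrite (det_rank1 (alpha_scalar H) gE) => /eqP.
  rewrite -subr_eq0 addrC addKr => /eqP ay.
  have gG : g \in G by case/stabP: gS.
  have gy : g y = y by apply/eqP; rewrite -subr_eq0 gE ay scale0r.
  apply/lfunP => v; rewrite id_lfunE; apply/eqP; rewrite -subr_eq0 gE.
  have := group_unitary G_group v y gG; rewrite gy -{1}[g v](subrK v) gE.
  rewrite (ip_linearl ip_inner) => /eqP; rewrite -subr_eq0 addrK mulf_eq0 conjC_eq0.
  rewrite scaler_eq0; case/orP => [->//|yy].
  by apply/orP; right; apply/negPn/negP => /(ip_pos ip_inner); rewrite (eqP yy) ltxx.
have S_group := stab_group ip_inner G_group H.
move=> g h gS hS gh; have gV := group_inv S_group gS.
have /det1_id : (g^-1 \o h)%VF \in stab G H by apply: (group_comp S_group).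
rewrite detM -gh (detV ip_inner S_group gS) => /(_ erefl) /(congr1 (comp_lfun g)).
by rewrite lker0_compVKf ?(group_lker0 ip_inner S_group) // comp_lfun1r.
Qed.

(** A nonzero sum would force det^i to be trivial on G_H, and the e_H distinct determinants would
    all be roots of unity of order dividing i, with i < e_H. *)
Lemma sum_det_stab i : (0 < i < eH G H)%N -> \sum_(g <- stab G H) det g ^+ i = 0.
Proof.
have S_group := stab_group ip_inner G_group H.
case/andP=> i0 ie; apply/eqP/negPn/negP => S0.
have det_root h : h \in stab G H -> det h ^+ i = 1.
  move=> hS; apply: (mulIf S0); rewrite mul1r mulr_sumr.
  rewrite [RHS](@big_group_mul _ _ _ _ ip_inner S_group C 0 +%R _ h hS).
  by apply: eq_bigr => g _; rewrite detM exprMn.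
have : (size [seq det g | g <- stab G H] <= i)%N.
  apply: max_unity_roots => //.
    by apply/allP => _ /mapP[h hS ->]; rewrite unity_rootE det_root.
  by rewrite map_inj_in_uniq ?fset_uniq //; apply: det_stab_inj.
by rewrite size_map leqNgt ie.
Qed.

Lemma sum_reflection_coeff : \sum_(g <- stab G H) reflection_coeff H g = 0.
Proof.
rewrite exchange_big big_nat; apply: big1 => i ie /=.
by rewrite -mulr_sumr sum_det_stab ?mulr0.
Qed.

(** For g in G_H the form g x_i - x_i vanishes on H, hence is a multiple of alpha_H; the commutator
    of a_H with x_i is therefore divisible by alpha_H. *)
Lemma aHX v0 i p : alpha H v0 = 1 -> aH G k H ('X_i * p) = 'X_i * aH G k H p
  + linpoly (alpha H) * \sum_(g <- stab G H)
      (reflection_coeff H g * crd i ((g^-1)%VF v0 - v0)) *: gact g p.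
Proof.
move=> av0; rewrite !aHE !mulr_sumr -big_split; apply: eq_big_seq => g gS /=.
have gV := group_inv (stab_group ip_inner G_group H) gS.
rewrite gactM gactX -!scalerAr -scalerA -scalerDr; congr (_ *: _).
rewrite scalerAl -mulrDl addrC; congr (_ * _).
rewrite -linpoly_crd -linpolyP; apply: eq_linpoly => v.
rewrite -{1}[(g^-1)%VF v](subrK v) (stab_rank1 _ gV av0).
by rewrite /crd linearD linearZ /= mulrC.
Qed.

Lemma linpoly_alpha_neq0 : linpoly (alpha H) != 0.
Proof.
have [v av] := alpha_neq0; apply/eqP => /(linpoly_eq0 (alpha_scalar H))/(_ v)/eqP.
by rewrite av oner_eq0.
Qed.

Definition dquo p := divp_lin (linpoly (alpha H)) (aH G k H p).

(** The division is exact, so the default value of [divp_lin] never appears: a_H kills 1 because the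
    coefficients sum to zero, and [aHX] propagates divisibility to products. *)
Lemma dquoE p : linpoly (alpha H) * dquo p = aH G k H p.
Proof.
suff : exists q, linpoly (alpha H) * q = aH G k H p by move/(xgetPex 0).
have [v0 av0] := alpha_neq0.
elim/mpoly_ind_X: p => [|a p p' [q qE] [q' qE']|i p [q qE]].
- exists 0; rewrite mulr0 aHE; under eq_bigr => g _ do rewrite gact1.
  by rewrite -scaler_suml sum_reflection_coeff scale0r.
- by exists (a *: q + q'); rewrite aH_linear mulrDr -scalerAr qE qE'.
by eexists; rewrite (aHX _ _ av0) -qE mulrCA -mulrDr.
Qed.

Lemma dquo_linear a p q : dquo (a *: p + q) = a *: dquo p + dquo q.
Proof.
apply: (mulfI linpoly_alpha_neq0).
move: (dquo p) (dquo q) (dquo _) (dquoE p) (dquoE q) (dquoE (a *: p + q)).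
by move=> x y z px qy ->; rewrite mulrDr -scalerAr px qy aH_linear.
Qed.

Lemma dquo1 : dquo 1 = 0.
Proof.
apply: (mulfI linpoly_alpha_neq0); rewrite mulr0 dquoE aHE.
under eq_bigr => g _ do rewrite gact1.
by rewrite -scaler_suml sum_reflection_coeff scale0r.
Qed.

(** The factor alpha_H(x) removes the auxiliary v0, as alpha_H(x) (g^-1 v0 - v0) = g^-1 x - x. *)
Lemma dquoX x i p : alpha H x *: dquo ('X_i * p) = 'X_i * (alpha H x *: dquo p)
  + \sum_(g <- stab G H)
      (reflection_coeff H g * crd i ((g^-1)%VF x - x)) *: gact g p.
Proof.
have [v0 av0] := alpha_neq0; apply: (mulfI linpoly_alpha_neq0).
move: (dquo p) (dquo ('X_i * p)) (dquoE p) (dquoE ('X_i * p)) => y z yE zE.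
rewrite -[LHS]scalerAr zE (aHX _ _ av0) scalerDr mulrDr.
congr (_ + _); first by rewrite -yE -!scalerAr mulrCA.
rewrite scalerAr scaler_sumr; congr (_ * _); apply: eq_big_seq => g gS.
have gV := group_inv (stab_group ip_inner G_group H) gS.
by rewrite (stab_rank1 x gV av0) scalerA /crd linearZ mulrCA.
Qed.

End Hyperplane.

Lemma refl_stab_neq1 H : refl H -> exists2 g, g \in stab G H & g != \1%VF.
Proof.
move=> [_ S1]; apply: contrapT => S_triv; apply: S1; apply/fsetP => g.
rewrite in_fset1; apply/idP/eqP => [gS|->].
  by apply/eqP/negPn/negP => g1; apply: S_triv; exists g.
exact: group_id (stab_group ip_inner G_group H).
Qed.

(** Each reflection hyperplane is the whole fixed space of some nontrivial g in G, by dimension.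
    Finiteness turns the sum over a set in [dunkl] into an ordinary finite sum. *)
Lemma refl_finite : finite_set refl.
Proof.
apply: (@sub_finite_set _ _ [set lker (g - \1%VF) | g in [set` G]]).
  move=> H H_refl; have [g gS g1] := refl_stab_neq1 H_refl.
  have /andP[gG gH] : (g \in G) && (H <= lker (g - \1%VF))%VS by move: gS; rewrite !inE.
  exists g => //; apply/esym/eqP; rewrite eqEdim gH -ltnS; case: H_refl => -> _.
  rewrite ltn_neqAle dimvS ?subvf // andbT; apply: contra g1 => /eqP dimg.
  have : lker (g - \1%VF) == {:V}%VS by rewrite eqEdim subvf dimg leqnn.
  move=> /eqP gker; apply/eqP/lfunP => v; apply/eqP.
  by rewrite -subr_eq0 -opp_lfunE -add_lfunE -memv_ker gker memvf.
exact/finite_image/finite_fset.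
Qed.

Definition refls := fset_set refl.

Lemma reflsP H : reflect (refl H) (H \in refls).
Proof. by rewrite in_fset_set ?inE; [apply: asboolP | apply: refl_finite]. Qed.

Lemma dunklE x p : dunkl G alpha k x p =
  dderiv x p + \sum_(H <- refls) alpha H x *: dquo H p.
Proof. by rewrite /dunkl fsbig_finite //; apply: refl_finite. Qed.

Lemma dderiv_linear x a (p q : P) :
  dderiv x (a *: p + q) = a *: dderiv x p + dderiv x q.
Proof.
rewrite /dderiv scaler_sumr -big_split; apply: eq_bigr => i _ /=.
by rewrite linearP /= scalerDr !scalerA mulrC.
Qed.

Lemma dunkl_linear x a p q :
  dunkl G alpha k x (a *: p + q) = a *: dunkl G alpha k x p + dunkl G alpha k x q.
Proof.
rewrite !dunklE dderiv_linear scalerDr addrACA; congr (_ + _).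
rewrite scaler_sumr -big_split.
apply: eq_big_seq => H /reflsP H_refl /=.
by rewrite dquo_linear // scalerDr !scalerA mulrC.
Qed.

Lemma dunkl_vec a x y p :
  dunkl G alpha k (a *: x + y) p = a *: dunkl G alpha k x p + dunkl G alpha k y p.
Proof.
rewrite !dunklE scalerDr addrACA; congr (_ + _).
  rewrite /dderiv scaler_sumr -big_split; apply: eq_bigr => i _ /=.
  by rewrite crd_lin scalerDl scalerA.
rewrite scaler_sumr -big_split; apply: eq_bigr => H _ /=.
by rewrite linearP scalerDl scalerA.
Qed.

Lemma dunkl1 x : dunkl G alpha k x 1 = 0.
Proof.
rewrite dunklE /dderiv !big1_seq ?addr0 // => [H /andP[_ /reflsP H_refl]|i _].
  by rewrite dquo1 ?scaler0.
by rewrite -mpolyC1 mderivC scaler0.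
Qed.

(** The c_g of the abstract relations. At g = 1 every reflection hyperplane contributes, harmlessly:
    c_g always multiplies a quantity that vanishes there. *)
Definition dunkl_coeff g := \sum_(H <- refls | g \in stab G H) reflection_coeff H g.

Lemma big_stab (W : nmodType) H (F : 'End(V) -> W) :
  \sum_(g <- stab G H) F g = \sum_(g <- G | g \in stab G H) F g.
Proof.
rewrite -[RHS]big_filter; apply: perm_big; apply: uniq_perm => [||g].
- exact: fset_uniq.
- exact/filter_uniq/fset_uniq.
by rewrite mem_filter; case: (boolP (g \in stab G H)) => // /stabP[-> _].
Qed.

(** The relation [opX] for Dunkl operators: Leibniz for the derivative, [dquoX] for each hyperplane,
    and an exchange of sums that collects the coefficient of each g. *)
Lemma dunklX x i p : dunkl G alpha k x ('X_i * p) =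
  'X_i * dunkl G alpha k x p + crd i x *: p
  + \sum_(g <- G) (dunkl_coeff g * crd i ((g^-1)%VF x - x)) *: gact g p.
Proof.
rewrite !dunklE mulrDr -[RHS]addrA addrACA; congr (_ + _); last first.
  transitivity (\sum_(H <- refls) ('X_i * (alpha H x *: dquo H p) +
     \sum_(g <- stab G H)
      (reflection_coeff H g * crd i ((g^-1)%VF x - x)) *: gact g p)).
    by apply: eq_big_seq => H /reflsP H_refl; exact: dquoX.
  rewrite big_split mulr_sumr /=; congr (_ + _).
  under eq_bigr => H _ do rewrite big_stab.
  rewrite (exchange_big_dep xpredT) //=; apply: eq_bigr => g _.
  by rewrite /dunkl_coeff mulr_suml scaler_suml.
rewrite /dderiv; under eq_bigr => j _ do rewrite mderivM scalerDr.
rewrite big_split /= addrC; congr (_ + _).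
  by rewrite mulr_sumr; apply: eq_bigr => j _; rewrite scalerAr.
rewrite (bigD1 i) //= big1 => [|j ji]; rewrite mderivX mnm1E.
  by rewrite eqxx scale1r -{1}[U_(i)%MM]add0m addmK mpolyX0 mul1r addr0.
by rewrite eq_sym (negPf ji) scale0r mul0r scaler0.
Qed.

Lemma dunkl_coeff_rank1 g : g \in G -> dunkl_coeff g != 0 ->
  exists (f : V -> C) (y : V), forall v, (g^-1)%VF v - v = f v *: y.
Proof.
move=> gG; case: (pselect (exists2 H, refl H & g \in stab G H)) => [[H H_refl gS] _|noH].
  have [v0 av0] := alpha_neq0 H_refl.
  exists (alpha H), ((g^-1)%VF v0 - v0) => v.
  have gV := group_inv (stab_group ip_inner G_group H) gS.
  exact: (stab_rank1 H_refl v gV av0).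
rewrite /dunkl_coeff big1_seq ?eqxx // => H /andP[gS /reflsP H_refl].
by case: noH; exists H.
Qed.

Lemma stabV g H : g \in G -> ((g^-1)%VF \in stab G H) = (g \in stab G H).
Proof.
move=> gG; have S_group := stab_group ip_inner G_group H.
apply/idP/idP => gS; last exact: (group_inv S_group).
by rewrite -(group_invV ip_inner G_group gG); apply: (group_inv S_group).
Qed.

(** The reality of k enters here; the determinants conjugate by unitarity. *)
Lemma dunkl_coeff_inv g : g \in G -> dunkl_coeff (g^-1)%VF = (dunkl_coeff g)^*.
Proof.
move=> gG; rewrite /dunkl_coeff rmorph_sum; apply: eq_big => [H|H _].
  exact: stabV.
rewrite /reflection_coeff rmorph_sum; apply: eq_bigr => i _ /=.
by rewrite rmorphM rmorphXn /= k_real (det_conj_inv ip_inner G_group gG).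
Qed.

Lemma stab_conj h H g : h \in G ->
  ((h \o g \o h^-1)%VF \in stab G (h @: H)%VS) = (g \in stab G H).
Proof.
move=> hG; have hVG := group_inv G_group hG.
apply/stabP/stabP => [[gG gH]|[gG gH]]; split.
- by rewrite -(group_conjK ip_inner G_group hG g); do 2?apply: (group_comp G_group).
- move=> v vH; have := gH (h v) (memv_img h vH).
  rewrite !comp_lfunE (groupK ip_inner G_group hG).
  exact: (can_inj (groupK ip_inner G_group hG)).
- by do 2?apply: (group_comp G_group).
- move=> _ /memv_imgP[v vH ->].
  by rewrite !comp_lfunE (groupK ip_inner G_group hG) gH.
Qed.

Lemma eH_conj h H : h \in G -> eH G (h @: H)%VS = eH G H.
Proof.
move=> hG; rewrite /eH.
rewrite -(size_map (fun g => h \o g \o h^-1)%VF (stab G H)).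
apply/perm_size/uniq_perm; first exact: fset_uniq.
  by rewrite map_inj_uniq ?fset_uniq //; apply/can_inj/(group_conjK ip_inner G_group hG).
move=> g; apply/idP/mapP => [gS|[g' g'S ->]]; last by rewrite stab_conj.
exists (h^-1 \o g \o h)%VF; last by rewrite (group_conjVK ip_inner G_group hG).
by rewrite -(stab_conj _ _ hG) (group_conjVK ip_inner G_group hG).
Qed.

Lemma refl_conj h H : h \in G -> refl H -> refl (h @: H)%VS.
Proof.
move=> hG H_refl; have [g gS g1] := refl_stab_neq1 H_refl.
case: H_refl => H_hyp _; split.
  rewrite /is_hyperplane limg_dim_eq //.
  by rewrite (eqP (group_lker0 ip_inner G_group hG)) capv0.
move=> S1; case/eqP: g1; apply: (can_inj (group_conjK ip_inner G_group hG)).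
have : (h \o g \o h^-1)%VF \in stab G (h @: H)%VS by rewrite stab_conj.
rewrite S1 in_fset1 => /eqP ->; rewrite comp_lfun1r.
by rewrite lker0_compfV ?(group_lker0 ip_inner G_group hG).
Qed.

Lemma hyp_orbit_conj h H : h \in G -> hyp_orbit G (h @: H)%VS = hyp_orbit G H.
Proof.
move=> hG; apply/seteqP; split=> _ [g gG ->].
  by exists (g \o h)%VF; rewrite ?(group_comp G_group) // limg_comp.
exists (g \o h^-1)%VF; first by rewrite (group_comp G_group) ?(group_inv G_group).
rewrite -limg_comp -comp_lfunA lker0_compVf ?comp_lfun1r //.
exact: (group_lker0 ip_inner G_group).
Qed.

(** The hyperplanes fixed by h g h^-1 are the images under h of those fixed by g, with the same e_H,
    the same orbit, hence the same parameters, and the same determinant. *)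
Lemma dunkl_coeff_conj g h : g \in G -> h \in G ->
  dunkl_coeff (h \o g \o h^-1)%VF = dunkl_coeff g.
Proof.
move=> gG hG; rewrite /dunkl_coeff [LHS]big_mkcond [RHS]big_mkcond /=.
have imgK (f f' : 'End(V)) (H : {vspace V}) :
    (f' \o f = \1)%VF -> (f' @: (f @: H) = H)%VS.
  by rewrite -limg_comp => ->; rewrite lim1g.
have hK := lker0_compVf (group_lker0 ip_inner G_group hG).
have hVK := lker0_compfV (group_lker0 ip_inner G_group hG).
rewrite (@big_fset_bij _ _ _ _ refls refls (fun H => h @: H)%VS).
- apply: eq_bigr => H _; rewrite stab_conj //; case: ifP => // _.
  rewrite /reflection_coeff eH_conj // hyp_orbit_conj //; apply: eq_bigr => i _.
  by rewrite !detM mulrAC (mulrC (det h)) (detV ip_inner G_group hG) mul1r.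
- by move=> H H' _ _ HH'; rewrite -(imgK _ _ H hK) HH' imgK.
move=> H; apply/idP/mapP => [/reflsP H_refl|[H' /reflsP H'_refl ->]].
  exists (h^-1 @: H)%VS; last by rewrite imgK.
  by apply/reflsP/refl_conj => //; apply: (group_inv G_group).
exact/reflsP/refl_conj.
Qed.

End DunklOperators.

(** * The pairing *)

Section SemilinearSubstitution.
Variables (C : numClosedFieldType) (n : nat) (l : 'I_n -> {mpoly C[n]}).

(** The images l are arbitrary so that [star] and its inverse are both instances. *)
Definition semisubst (s : {mpoly C[n]}) : {mpoly C[n]} :=
  map_mpoly Num.conj s \mPo [tuple l i | i < n].

Lemma semisubst_linear a p q :
  semisubst (a *: p + q) = a^* *: semisubst p + semisubst q.
Proof. by rewrite /semisubst raddfD /= map_mpolyZ comp_mpolyD comp_mpolyZ. Qed.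

Lemma semisubst1 : semisubst 1 = 1.
Proof. by rewrite /semisubst !rmorph1. Qed.

Lemma semisubstM p q : semisubst (p * q) = semisubst p * semisubst q.
Proof. by rewrite /semisubst !rmorphM. Qed.

Lemma semisubstX i : semisubst 'X_i = l i.
Proof. by rewrite /semisubst map_mpolyX comp_mpolyXU -tnth_nth tnth_mktuple. Qed.

Lemma semisubst_sum (I : Type) (r : seq I) (a : I -> C) (F : I -> {mpoly C[n]}) :
  semisubst (\sum_(i <- r) a i *: F i) = \sum_(i <- r) (a i)^* *: semisubst (F i).
Proof.
elim: r => [|i r IHr]; first by rewrite !big_nil /semisubst !raddf0.
by rewrite !big_cons semisubst_linear IHr.
Qed.

End SemilinearSubstitution.

Section Star.
Variables (C : numClosedFieldType) (V : vectType C) (ip : V -> V -> C).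
Local Notation P := {mpoly C[dimV V]}.
Hypothesis ip_inner : inner_product ip.

Lemma starE (s : P) : star ip s = semisubst (fun i => linpoly (ip (bas i))) s.
Proof. by []. Qed.

(** The vector x as a degree one element of the symmetric algebra. *)
Definition vec_mpoly (x : V) : P := \sum_i crd i x *: 'X_i.

Lemma vec_mpoly_bas i : vec_mpoly (bas i) = 'X_i.
Proof.
rewrite /vec_mpoly (bigD1 i) //= crd_bas eqxx scale1r big1 ?addr0 // => j ji.
by rewrite crd_bas (negPf ji) scale0r.
Qed.

Lemma star_vec x : star ip (vec_mpoly x) = linpoly (ip x).
Proof.
rewrite starE /vec_mpoly semisubst_sum.
under eq_bigr => i _ do rewrite semisubstX scaler_sumr.
rewrite exchange_big; apply: eq_bigr => j _ /=.
rewrite {2}(bas_crd x) (ip_suml ip_inner) scaler_suml.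
by apply: eq_bigr => i _; rewrite scalerA.
Qed.

Lemma star_surj p : exists s, star ip s = p.
Proof.
elim/(mpoly_ind_ip ip_inner): p => [|a p q [s <-] [t <-]|x p [s <-]].
- by exists 1; rewrite starE semisubst1.
- by exists (a^* *: s + t); rewrite !starE semisubst_linear conjCK.
by exists (vec_mpoly x * s); rewrite [LHS]starE semisubstM -!starE star_vec.
Qed.

(** A left inverse is the semilinear substitution sending each coordinate to the vector that
    represents it through [ip]. *)
Lemma star_inj : injective (star ip).
Proof.
have /choice[xi xiE] : forall i, exists x, forall v, ip x v = crd i v.
  by move=> i; apply: (riesz ip_inner); apply: crd_lin.
suff starK : cancel (star ip) (semisubst (fun i => vec_mpoly (xi i))).
  exact: can_inj starK.
elim/mpoly_ind_X => [|a s t IHs IHt|i s IHs].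
- by rewrite starE !semisubst1.
- by rewrite [X in semisubst _ X]starE !semisubst_linear -!starE IHs IHt conjCK.
rewrite [X in semisubst _ X]starE !semisubstM -!starE IHs; congr (_ * _).
rewrite starE semisubstX semisubst_sum -vec_mpoly_bas.
under eq_bigr => j _ do rewrite semisubstX scaler_sumr.
rewrite exchange_big; apply: eq_bigr => j _ /=.
under eq_bigr => l _ do rewrite scalerA.
rewrite -scaler_suml; congr (_ *: _).
(* Both sides represent the same linear form, because [ip (xi l)] is the l-th coordinate. *)
have basE : bas i = \sum_l (ip (bas i) (bas l))^* *: xi l.
  apply/eqP; rewrite -subr_eq0; apply/eqP/(ip_nondeg ip_inner) => v.
  rewrite (ipBl ip_inner) (ip_suml ip_inner) (scalarE (ip_scalar ip_inner _) v).
  by rewrite -sumrB big1 // => l _; rewrite conjCK xiE mulrC subrr.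
rewrite [in RHS]basE /crd linear_sum /=; apply: eq_bigr => l _.
by rewrite linearZ.
Qed.

Lemma unstarK p : star ip (unstar ip p) = p.
Proof. exact: (xgetPex 0 (star_surj p)). Qed.

Lemma starK s : unstar ip (star ip s) = s.
Proof. exact/star_inj/unstarK. Qed.

Lemma unstar_linear a p q : unstar ip (a *: p + q) = a^* *: unstar ip p + unstar ip q.
Proof.
by apply: star_inj; rewrite unstarK starE semisubst_linear conjCK -!starE !unstarK.
Qed.

Lemma unstar1 : unstar ip 1 = 1.
Proof. by apply: star_inj; rewrite unstarK starE semisubst1. Qed.

Lemma unstarM x p : unstar ip (linpoly (ip x) * p) = vec_mpoly x * unstar ip p.
Proof.
by apply: star_inj; rewrite unstarK [RHS]starE semisubstM -!starE star_vec unstarK.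
Qed.

End Star.

(** * Evaluating the symmetric algebra at commuting operators *)

Section Evaluation.
Variables (C : numClosedFieldType) (V : vectType C).
Local Notation P := {mpoly C[dimV V]}.
Variable T : V -> P -> P.
Hypothesis T_linear : forall x a p q, T x (a *: p + q) = a *: T x p + T x q.
Hypothesis T_vec : forall a x y p, T (a *: x + y) p = a *: T x p + T y p.
Hypothesis T_comm : forall x y p, T x (T y p) = T y (T x p).

(** The list r is a parameter to allow induction on it; with the full enumeration of indices,
    [eval_op] is convertible to [eval_dunkl]. *)
Definition monomial_op (r : seq 'I_(dimV V)) (m : 'X_{1..dimV V}) : P -> P :=
  \big[(fun f g : P -> P => f \o g)/id]_(i <- r) iter (m i) (T (bas i)).

Definition eval_op (s q : P) : P :=
  \sum_(m <- msupp s) s@_m *: monomial_op (index_enum _) m q.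

Lemma monomial_op_cons i r m q :
  monomial_op (i :: r) m q = iter (m i) (T (bas i)) (monomial_op r m q).
Proof. by rewrite /monomial_op big_cons. Qed.

Lemma monomial_op_linear r m a p q :
  monomial_op r m (a *: p + q) = a *: monomial_op r m p + monomial_op r m q.
Proof.
elim: r => [|i r IHr]; first by rewrite /monomial_op !big_nil.
rewrite !monomial_op_cons IHr; elim: (m i) => //= e ->.
by rewrite T_linear.
Qed.

Lemma monomial_op_comm r m x q : T x (monomial_op r m q) = monomial_op r m (T x q).
Proof.
elim: r => [|i r IHr]; first by rewrite /monomial_op !big_nil.
rewrite !monomial_op_cons -IHr; elim: (m i) => //= e <-.
by rewrite T_comm.
Qed.

(** Each occurrence of i in r contributes one more T_i, moved innermost by commutativity; the full
    enumeration contains i exactly once. *)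
Lemma monomial_op_add r i m q :
  monomial_op r (U_(i) + m)%MM q = monomial_op r m (iter (count_mem i r) (T (bas i)) q).
Proof.
elim: r => [|j r IHr]; first by rewrite /monomial_op !big_nil.
rewrite !monomial_op_cons IHr /= mnmDE mnm1E eq_sym.
case: eqP => [->|_]; last by rewrite add0n.
by rewrite !add1n iterSr monomial_op_comm.
Qed.

Lemma eval_opE (r : seq 'X_{1..dimV V}) s q : uniq r -> {subset msupp s <= r} ->
  eval_op s q = \sum_(m <- r) s@_m *: monomial_op (index_enum _) m q.
Proof.
move=> r_uniq sr; rewrite [RHS](bigID (mem (msupp s))) /= addrC big1 ?add0r.
  rewrite -big_filter; apply/perm_big/uniq_perm; rewrite ?filter_uniq ?msupp_uniq //.
  by move=> m; rewrite mem_filter; case: (boolP (m \in msupp s)) => // /sr.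
by move=> m /memN_msupp_eq0 ->; rewrite scale0r.
Qed.

Lemma eval_op_linearl a s t q :
  eval_op (a *: s + t) q = a *: eval_op s q + eval_op t q.
Proof.
pose r := undup (msupp s ++ msupp t ++ msupp (a *: s + t)).
have rE m : m \in r = [|| m \in msupp s, m \in msupp t | m \in msupp (a *: s + t)].
  by rewrite mem_undup !mem_cat.
rewrite !(@eval_opE r) ?undup_uniq //; try by move=> m mS; rewrite rE mS ?orbT.
rewrite scaler_sumr -big_split.
by apply: eq_bigr => m _ /=; rewrite linearP /= scalerDl scalerA.
Qed.

Lemma eval_op_linearr a s p q :
  eval_op s (a *: p + q) = a *: eval_op s p + eval_op s q.
Proof.
rewrite /eval_op scaler_sumr -big_split; apply: eq_bigr => m _ /=.
by rewrite monomial_op_linear scalerDr !scalerA mulrC.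
Qed.

Lemma eval_opX m q : eval_op 'X_[m] q = monomial_op (index_enum _) m q.
Proof. by rewrite /eval_op msuppX big_seq1 mcoeffX eqxx scale1r. Qed.

Lemma eval_op1 q : eval_op 1 q = q.
Proof.
rewrite -mpolyX0 eval_opX; elim: (index_enum _) => [|i r IHr].
  by rewrite /monomial_op big_nil.
by rewrite monomial_op_cons IHr mnm0E.
Qed.

Lemma eval_opXM i s q : eval_op ('X_i * s) q = eval_op s (T (bas i) q).
Proof.
elim/mpolyind: s => [|a m s _ _ IHs].
  by rewrite mulr0 /eval_op msupp0 !big_nil.
rewrite mulrDr -scalerAr -mpolyXD !eval_op_linearl IHs !eval_opX monomial_op_add.
by rewrite count_uniq_mem ?index_enum_uniq // mem_index_enum.
Qed.

Lemma eval_op_vec x s q : eval_op (vec_mpoly x * s) q = eval_op s (T x q).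
Proof.
have ev0 p : eval_op 0 p = 0 by rewrite /eval_op msupp0 big_nil.
have er0 t : eval_op t 0 = 0.
  by rewrite -[X in eval_op _ X](addNr (1 : P)) -scaleN1r eval_op_linearr scaleN1r addNr.
have T0 p : T 0 p = 0.
  by rewrite -[X in T X _](addNr (0 : V)) -scaleN1r T_vec scaleN1r addNr.
rewrite {2}(bas_crd x) /vec_mpoly mulr_suml.
elim: (index_enum _) => [|i r IHr]; first by rewrite !big_nil ev0 T0 er0.
by rewrite !big_cons -scalerAl eval_op_linearl IHr eval_opXM T_vec eval_op_linearr.
Qed.

End Evaluation.

(** * Submodules and quotients *)

Section LargestProperSubmodule.
Variables (P : zmodType) (A : set (P -> P)).
Hypothesis A_additive : forall a, A a -> {morph a : x y / x - y}.

Section Quotient.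
Variables (N : set P) (hN : submodule A (@nat_act P) N).

Definition quot_pi (x : P) : quot_module hN := \pi_(quot_module hN)%qT x.

Lemma quot_piB x y : quot_pi (x - y) = quot_pi x - quot_pi y.
Proof. exact: raddfB. Qed.

Lemma quot_pi_eq x y : quot_pi x = quot_pi y <-> N (x - y).
Proof.
split=> [/eqP|Nxy]; last apply/eqP.
  by rewrite -[_ == _]/(_ == _ %[mod quot_module hN])%qT -Quotient.idealrBE => /asboolP.
by rewrite -[_ == _]/(_ == _ %[mod quot_module hN])%qT -Quotient.idealrBE; apply/asboolP.
Qed.

Lemma quot_pi_surj u : exists x, quot_pi x = u.
Proof. by exists (repr u); apply: reprK. Qed.

Lemma quot_pi_eq0 x : quot_pi x = 0 <-> N x.
Proof.
by rewrite -(subrr (quot_pi 0)) -quot_piB quot_pi_eq subrr subr0.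
Qed.

(** The action is computed on a chosen representative; another one differs by an element of N, which
    the additive a maps into N. *)
Lemma quot_actE a x : A a ->
  @quot_act P A N hN a (quot_pi x) = quot_pi (a x).
Proof.
move=> Aa; rewrite -[LHS]/(quot_pi (a (repr (quot_pi x)))).
apply: (iffRL (quot_pi_eq _ _)); rewrite -(A_additive Aa).
have [_ _ NA] := hN; apply: NA => //.
by apply: (iffLR (quot_pi_eq _ _)); apply: reprK.
Qed.

Lemma submodule_preim (L : set (quot_module hN)) :
  submodule A (@quot_act P A N hN) L ->
  submodule A (@nat_act P) [set x | L (quot_pi x)].
Proof.
move=> [L0 LB LA]; split=> /= [|x y Lx Ly|a x Aa Lx].
- by have /quot_pi_eq0 -> : N 0 by case: hN.
- by rewrite quot_piB; apply: LB.
- by rewrite -quot_actE //; apply: LA.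
Qed.

Lemma submodule_image (L : set P) : submodule A (@nat_act P) L ->
  submodule A (@quot_act P A N hN) [set quot_pi x | x in L].
Proof.
move=> [L0 LB LA]; split=> [|_ _ [x Lx <-] [y Ly <-]|a _ Aa [x Lx <-]].
- by exists 0 => //; apply/quot_pi_eq0; case: hN.
- by exists (x - y); [apply: LB | apply: quot_piB].
- by exists (a x); [apply: LA | rewrite quot_actE].
Qed.

End Quotient.

Variable L : set P.
Hypothesis L_submodule : submodule A (@nat_act P) L.
Hypothesis L_proper : L <> [set: P].
Hypothesis L_largest : forall N, submodule A (@nat_act P) N -> N <> [set: P] -> N `<=` L.

Lemma largest_maximalP N : maximal_proper_submodule A N <-> N = L.
Proof.
split=> [[N_sub N_proper N_max]|->].
  by apply/esym/N_max => //; apply: L_largest.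
by split=> // N' N'_sub N'_proper LN'; apply/seteqP; split=> //; apply: L_largest.
Qed.

Lemma largest_simpleP : ~ simple_module A (@nat_act P) <-> exists2 x, L x & x != 0.
Proof.
split=> [not_simple|[x Lx x0] [_ /(_ L L_submodule)[L0|LT]]].
- apply: contrapT => noL; apply: not_simple.
  have L0 x : L x -> x = 0.
    by move=> Lx; apply/eqP/negPn/negP => x0; apply: noL; exists x.
  split=> [|N N_sub].
    (* If P were zero, then L, which contains 0, would not be proper. *)
    apply: contrapT => P0; apply: L_proper; apply/seteqP; split=> // x _.
    have -> : x = 0; last by case: L_submodule.
    by apply/eqP/negPn/negP => x0; apply: P0; exists x.
  case: (pselect (N = [set: P])) => [->|N_proper]; [by right | left].
  apply/seteqP; split=> [x /(L_largest N_sub N_proper)/L0 //|_ ->].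
  by case: N_sub.
- by move: Lx x0; rewrite L0 => ->; rewrite eqxx.
- exact: L_proper LT.
Qed.

(** The preimage in P of a submodule of P/L is all of P or is contained in L. *)
Lemma largest_quot_simple : simple_module A (@quot_act P A L L_submodule).
Proof.
split=> [|N N_sub].
  apply: contrapT => Q0; apply: L_proper; apply/seteqP; split=> // x _.
  apply/(quot_pi_eq0 L_submodule)/eqP/negPn/negP => x0.
  by apply: Q0; exists (quot_pi L_submodule x).
case: (pselect ([set x | N (quot_pi L_submodule x)] = [set: P])) => [NT|N_proper].
  right; apply/seteqP; split=> // u _; have [x <-] := quot_pi_surj u.
  by have : [set: P] x by []; rewrite -NT.
left; apply/seteqP; split=> [u Nu|_ ->]; last by case: N_sub.
have [x xu] := quot_pi_surj u; rewrite -xu; apply/quot_pi_eq0.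
by apply: (L_largest (submodule_preim N_sub) N_proper); rewrite /= xu.
Qed.

(** As P/N is nonzero, N is contained in L. The image of L in P/N is zero, giving L = N, or
    everything, giving P = L + N = L, which is excluded. *)
Lemma largest_quot_unique N (hN : submodule A (@nat_act P) N) :
  simple_module A (@quot_act P A N hN) -> N = L.
Proof.
move=> [[u u0] N_simple].
have N_proper : N <> [set: P].
  move=> NT; have [x xu] := quot_pi_surj u; case/eqP: u0; rewrite -xu.
  by apply/quot_pi_eq0; rewrite NT.
have NL := L_largest hN N_proper; apply/seteqP; split=> // x Lx.
case: (N_simple _ (submodule_image hN L_submodule)) => [L0|LT].
  have : [set quot_pi hN y | y in L] (quot_pi hN x) by exists x.
  by rewrite L0 => /quot_pi_eq0.
case: L_proper; apply/seteqP; split=> // y _.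
have : [set: quot_module hN] (quot_pi hN y) by [].
rewrite -LT => -[z Lz /esym/quot_pi_eq/NL Lyz].
have [L0 LB _] := L_submodule.
by have := LB _ _ Lyz (LB _ _ L0 Lz); rewrite sub0r opprK subrK.
Qed.

End LargestProperSubmodule.

(** * The polynomial module of the Cherednik algebra *)

Section CherednikModule.
Variables (C : numClosedFieldType) (V : vectType C) (ip : V -> V -> C).
Variables (G : {fset 'End(V)}) (alpha : {vspace V} -> 'Hom(V, C^o)).
Variable k : set {vspace V} -> nat -> C.
Local Notation P := {mpoly C[dimV V]}.
Local Notation A := (cherednik G alpha k).
Hypothesis ip_inner : inner_product ip.
Hypothesis G_group : unitary_subgroup ip [set` G].
Hypothesis alphaP : forall H, reflection_hyperplane G H -> lker (alpha H) = H.
Hypothesis k_real : forall O i, (k O i)^* = k O i.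

Local Notation T := (dunkl G alpha k).

Let T_linear := dunkl_linear k ip_inner G_group alphaP.
Let T_vec := dunkl_vec alpha k ip_inner G_group.
Let T1 := dunkl1 k ip_inner G_group alphaP.
Let TX := dunklX k ip_inner G_group alphaP.
Let c_conj g h := @dunkl_coeff_conj _ _ _ _ k ip_inner G_group g h.
Let c_inv g := @dunkl_coeff_inv _ _ _ _ _ ip_inner G_group k_real g.
Let c_rank1 g := @dunkl_coeff_rank1 _ _ _ _ _ k ip_inner G_group alphaP g.

Lemma dunkl_comm x y p : T x (T y p) = T y (T x p).
Proof. exact: (op_comm ip_inner G_group T_linear T_vec T1 TX c_conj c_rank1). Qed.

Local Notation B := (pairing G alpha k ip).

Lemma pairingE p q : B p q = (eval_op T (unstar ip p) q).@[fun=> 0].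
Proof. by []. Qed.

Lemma pairing_linearl a p q r : B (a *: p + q) r = a^* * B p r + B q r.
Proof.
by rewrite !pairingE unstar_linear // eval_op_linearl mevalD mevalZ.
Qed.

Lemma pairing_linearr a p q r : B r (a *: p + q) = a * B r p + B r q.
Proof. by rewrite !pairingE (eval_op_linearr T_linear) mevalD mevalZ. Qed.

Lemma pairing1 q : B 1 q = q.@[fun=> 0].
Proof. by rewrite pairingE unstar1 // eval_op1. Qed.

Lemma pairingM x p q : B (linpoly (ip x) * p) q = B p (T x q).
Proof.
by rewrite !pairingE unstarM // (eval_op_vec T_linear T_vec dunkl_comm).
Qed.

Lemma cherednik_additive a : A a -> {morph a : x y / x - y}.
Proof.
elim=> [f||||] //.
- move=> [[[g _ <-]|[x _ <-]]|[q _ <-]] u v /=.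
  + by rewrite /gact raddfB.
  + by rewrite addrC -scaleN1r T_linear scaleN1r addrC.
  + by rewrite mulrBr.
- by move=> c f _ IHf u v; rewrite IHf scalerBr.
- by move=> f g _ IHf _ IHg u v; rewrite IHf IHg opprD addrACA.
- by move=> f g _ IHf _ IHg u v /=; rewrite IHg IHf.
Qed.

(** Scalars belong to the algebra as multiples of the identity, so additive submodules are
    subspaces; conversely, multiplication by any polynomial is built from the coordinates. *)
Lemma stable_submodule N : submodule A (@nat_act P) N <-> stable G T N.
Proof.
split=> [[N0 NB NA]|N_st].
  have NZ c p : N p -> N (c *: p).
    by apply: (NA (fun p => c *: p)); apply/gen_scale/gen_one.
  split=> // [c p q Np Nq|i p|x p|g p gG].
  - by rewrite addrC -[c]opprK scaleNr; apply/NB/NZ.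
  - by apply: (NA (fun p => 'X_i * p)); apply: gen_in; right; exists 'X_i.
  - by apply: (NA (T x)); apply: gen_in; left; right; exists x.
  - by apply: (NA (gact g)); apply: gen_in; left; left; exists g.
case: (N_st) => N0 _ NX NT NG.
split=> [//|p q|a p Aa]; first exact: (stableB N_st).
move: a Aa p; rewrite /nat_act; apply: gen_algebra_ind => [f||||].
- move=> [[[g gG <-]|[x _ <-]]|[q _ <-]] p; [exact: NG | exact: NT |].
  elim/mpoly_ind_X: q => [|c q r IHq IHr|i q IHq] Np; first by rewrite mul1r.
    by rewrite mulrDl -scalerAl; apply: (stable_lin N_st); [apply: IHq | apply: IHr].
  by rewrite -mulrA; apply/NX/IHq.
- by [].
- by move=> c f _ IHf p /IHf; apply: (stableZ N_st).
- by move=> f g _ IHf _ IHg p Np; apply: (stableD N_st); [apply: IHf | apply: IHg].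
- by move=> f g _ IHf _ IHg p Np /=; apply/IHf/IHg.
Qed.

Lemma Rad_submodule : submodule A (@nat_act P) (Rad G alpha k ip).
Proof.
apply/stable_submodule.
exact: (radical_stable ip_inner G_group T_linear T1 TX c_conj c_inv
  pairing_linearl pairing_linearr pairing1 pairingM).
Qed.

Lemma Rad_proper : Rad G alpha k ip <> [set: P].
Proof.
move=> RT; apply: (radical1 pairing1).
by have : [set: P] 1 by []; rewrite -RT.
Qed.

Lemma Rad_largest N : submodule A (@nat_act P) N -> N <> [set: P] ->
  N `<=` Rad G alpha k ip.
Proof.
move=> N_sub N_proper.
apply: (stable_sub_radical ip_inner G_group T_linear T1 TX c_conj c_inv
  pairing_linearl pairing_linearr pairing1 pairingM); first exact/stable_submodule.
(* A submodule containing 1 contains every p = p * 1. *)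
move=> N1; apply: N_proper; apply/seteqP; split=> // p _.
have [_ _ NA] := N_sub; rewrite -[p]mulr1.
by apply: (NA (fun q => p * q)) => //; apply: gen_in; right; exists p.
Qed.

Lemma Rad_neq0P : (exists2 p, Rad G alpha k ip p & p != 0) <-> singular G alpha k.
Proof.
exact: (radical_neq0P ip_inner G_group T_linear T1 TX c_conj c_inv
  pairing_linearl pairing_linearr pairing1 pairingM).
Qed.

End CherednikModule.

Theorem proposition2p34 (R : realType) (V : vectType R[i])
    (ip : V -> V -> R[i]) (G : {fset 'End(V)})
    (alpha : {vspace V} -> 'Hom(V, R[i]^o))
    (k : set {vspace V} -> nat -> R) :
  inner_product ip ->
  complex_reflection_group ip G ->
  (forall H, reflection_hyperplane G H -> lker (alpha H) = H) ->
  let kC := fun O i => ((k O i)%:C)%C in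
  let A := cherednik G alpha kC in
  let Radk := Rad G alpha kC ip in
  [/\ forall N, maximal_proper_submodule A N <-> N = Radk,
      ~ simple_module A (@nat_act _) <-> singular G alpha kC
    & exists hRad : submodule A (@nat_act _) Radk,
        simple_module A (@quot_act _ A Radk hRad) /\
        forall N (hN : submodule A (@nat_act _) N),
          simple_module A (@quot_act _ A N hN) -> N = Radk].
Proof.
move=> ip_inner [G_group _] alphaP kC A Radk.
have k_real O i : (kC O i)^* = kC O i by apply: conjc_real.
have R_sub : submodule A (@nat_act _) Radk.
  exact: (Rad_submodule ip_inner G_group alphaP k_real).
have R_proper := @Rad_proper _ V ip G alpha kC ip_inner.
have R_largest := Rad_largest ip_inner G_group alphaP k_real.
have A_add := @cherednik_additive _ V ip G alpha kC ip_inner G_group alphaP.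
split; first exact: (largest_maximalP R_sub R_proper R_largest).
  rewrite -(Rad_neq0P ip_inner G_group alphaP k_real).
  exact: (largest_simpleP R_sub R_proper R_largest).
exists R_sub; split; first exact: largest_quot_simple.
by move=> N hN; apply: largest_quot_unique.
Qed.
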